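(* Let $F,G\in\mathbb{Z}[x]\setminus\{0\}$ satisfy $\deg F,\deg G\le 2$, and let $C,U,V$ be their support factors. Then $$\mathcal{P}(F,G)\quad\Longleftrightarrow\quad UV\text{ and at least one of }F,G\text{ are intersective}.$$ Moreover, $$\mathcal{P}(F,G)\quad\Longleftrightarrow\quad \mathcal{P}\bigl(\mathrm{rad}_{\mathbb{Q}}(F),\mathrm{rad}_{\mathbb{Q}}(G)\bigr).$$
   Context: $\mathbb{N}=\{1,2,\ldots\}$. For $A\subset\mathbb{N}$ and $m\in\mathbb{Z}$, put $d_A(m)=\#\{a\in A: a\mid m\}$, which may be infinite (in particular $d_A(0)=|A|$). For $u,v\in\mathbb{Z}$ define $\delta_A(u,v)=0$ if $u=v=0$; $\delta_A(u,v)=\infty$ if exactly one of $u,v$ is zero; $\delta_A(u,v)=|d_A(u)-d_A(v)|$ if $uv\neq 0$. For $F,G\in\mathbb{Z}[x]$, $\mathcal{P}(F,G)$ denotes the property: for every infinite $A\subset\mathbb{N}$, $\limsup_{n\to\infty}\delta_A(F(n),G(n))=\infty$ ($n$ running over positive integers). A polynomial $H\in\mathbb{Z}[x]$ is intersective if for every integer $m\ge 1$ there exists $n\in\mathbb{Z}$ with $H(n)\equiv 0\pmod m$. Support factors: write a nonzero $P\in\mathbb{Z}[x]$ as $P=c_P\prod_{\phi\in\mathcal{I}_P}\phi^{e_P(\phi)}$ with $c_P\in\mathbb{Z}\setminus\{0\}$, $e_P(\phi)\ge 1$, and $\mathcal{I}_P$ a finite set of pairwise nonassociate (nonconstant) primitive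 irreducible polynomials in $\mathbb{Z}[x]$ with positive leading coefficients. For nonzero $F,G$, set $C=\prod_{\phi\in\mathcal{I}_F\cap\mathcal{I}_G}\phi$, $U=\prod_{\phi\in\mathcal{I}_F\setminus\mathcal{I}_G}\phi$, $V=\prod_{\phi\in\mathcal{I}_G\setminus\mathcal{I}_F}\phi$, an empty product being $1$. The squarefree radical over $\mathbb{Q}$, represented primitively in $\mathbb{Z}[x]$, is $\mathrm{rad}_{\mathbb{Q}}(P)=\prod_{\phi\in\mathcal{I}_P}\phi$ (up to sign); thus, up to signs, $\mathrm{rad}_{\mathbb{Q}}(F)=CU$ and $\mathrm{rad}_{\mathbb{Q}}(G)=CV$. *)

(* Defs.v *)
From HB Require Import structures.
From mathcomp Require Import all_boot all_order all_algebra finmap.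
From mathcomp Require Import all_classical all_reals all_analysis.

Set Implicit Arguments.
Unset Strict Implicit.
Unset Printing Implicit Defensive.

Import Order.TTheory GRing.Theory Num.Theory.
Local Open Scope ring_scope.
Local Open Scope classical_set_scope.

(* The real field [R] only provides the type [\bar R] in which the possibly
   infinite cardinals and the limsup live; [counting] is [+oo] on infinite
   sets. *)
Definition divisor_count (R : realType) (A : set nat) (m : int) : \bar R :=
  counting [set a : nat | A a /\ (a%:Z %| m)%Z].

Definition divisor_gap (R : realType) (A : set nat) (u v : int) : \bar R :=
  if (u == 0) && (v == 0) then 0%E
  else if (u == 0) || (v == 0) then +oo%E
  else `|divisor_count R A u - divisor_count R A v|%E.

(* The [n]-th term of the sequence is taken at the positive integer [n.+1]. *)
Definition unbounded_gaps (R : realType) (F G : {poly int}) : Prop :=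
  forall A : set nat, (forall a, A a -> (0 < a)%N) -> infinite_set A ->
    limn_esup (fun n : nat =>
      divisor_gap R A F.[(n.+1)%:Z] G.[(n.+1)%:Z]) = +oo%E.

Definition intersective (H : {poly int}) : Prop :=
  forall m : nat, (1 <= m)%N -> exists n : int, (H.[n] = 0 %[mod m%:Z])%Z.

(* Unlike [irreducible_poly], which for integer coefficients means
   irreducibility over the rationals, this is irreducibility in the ring. *)
Definition irreducible_elt (D : idomainType) (p : D) : Prop :=
  [/\ p != 0, p \isn't a GRing.unit &
      forall q r : D, p = q * r -> q \is a GRing.unit \/ r \is a GRing.unit].

(* [zcontents phi] carries the sign of the leading coefficient, so that
   [zcontents phi = 1] says that [phi] is primitive with positive leading
   coefficient; in particular distinct such polynomials are nonassociate. *)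
Definition prime_factor (phi : {poly int}) : Prop :=
  [/\ (1 < size phi)%N, zcontents phi = 1 & irreducible_elt phi].

Definition is_support (P : {poly int}) (I : {fset {poly int}}) : Prop :=
  (forall phi, phi \in I -> prime_factor phi) /\
  exists (c : int) (e : {poly int} -> nat),
    [/\ c != 0, forall phi, phi \in I -> (1 <= e phi)%N &
        P = c%:P * \prod_(phi <- I) phi ^+ e phi].

(* When [is_support P I], this is the squarefree radical of [P] over the
   rationals, normalized primitive with positive leading coefficient. *)
Definition support_prod (I : {fset {poly int}}) : {poly int} :=
  \prod_(phi <- I) phi.

Definition support_only (I J : {fset {poly int}}) : {poly int} :=
  support_prod (I `\` J)%fset.

Lemma size_factor_gt1 (p q r : {poly int}) :
  zcontents p = 1 -> p = q * r -> q \isn't a GRing.unit -> (1 < size q)%N.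
Proof.
move=> cp epq nu; rewrite ltnNge; apply/negP => /size1_polyC eq.
move: cp nu; rewrite epq eq mul_polyC zcontentsZ poly_unitE /= => cp.
have u : q`_0 \is a GRing.unit by apply/unitrPr; exists (zcontents r).
have n0 : q`_0 != 0 by apply: contraTneq u => ->; rewrite unitr0.
by rewrite size_polyC n0 coefC eqxx u.
Qed.

Lemma prime_factorization_seq n (p : {poly int}) :
  (size p <= n)%N -> zcontents p = 1 ->
  exists2 s : seq {poly int}, (forall phi, phi \in s -> prime_factor phi) &
    p = \prod_(phi <- s) phi.
Proof.
elim: n p => [|n IHn] p.
  by rewrite leqn0 size_poly_eq0 => /eqP ->; rewrite zcontents0.
move=> sp cp.
have p0 : p != 0 by apply/eqP => p0; move: cp; rewrite p0 zcontents0.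
have [sp1|sp1] := leqP (size p) 1.
  exists [::] => //; rewrite big_nil; move: cp.
  rewrite (size1_polyC sp1) -[X in zcontents X]mulr1 mul_polyC zcontentsZ.
  by rewrite zcontents_monic ?monic1 // mulr1 => ->.
have pu : p \isn't a GRing.unit.
  by rewrite poly_unitE; case: eqP sp1 => // ->.
have [irr|nirr] := pselect (irreducible_elt p).
  by exists [:: p]; rewrite ?big_seq1 // => phi /[!inE] /eqP ->.
have [q [r [epq qu ru]]] : exists q r : {poly int},
    [/\ p = q * r, q \isn't a GRing.unit & r \isn't a GRing.unit].
  apply: contrapT => h; apply: nirr; split => // q r e.
  have [|qu] := boolP (q \is a GRing.unit); first by left.
  have [|ru] := boolP (r \is a GRing.unit); first by right.
  by case: h; exists q, r.
have q1 := size_factor_gt1 cp epq qu.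
have r1 := size_factor_gt1 cp (etrans epq (mulrC _ _)) ru.
have q0 : q != 0 by apply: contraTneq q1 => ->; rewrite size_poly0.
have r0 : r != 0 by apply: contraTneq r1 => ->; rewrite size_poly0.
have sE : size p = (size q + size r).-1 by rewrite epq size_mul.
have [||s hs es] := IHn (zprimitive q).
- rewrite size_zprimitive -ltnS (leq_trans _ sp) // sE.
  by case: (size r) r1 => [|[|k]] // _; rewrite !addnS /= ltnS leq_addr.
- by rewrite zcontents_primitive q0.
have [||t ht et] := IHn (zprimitive r).
- rewrite size_zprimitive -ltnS (leq_trans _ sp) // sE.
  by case: (size q) q1 => [|[|k]] // _; rewrite !addSn /= ltnS leq_addl.
- by rewrite zcontents_primitive r0.
exists (s ++ t).
  by move=> phi; rewrite mem_cat => /orP[/hs|/ht].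
by rewrite big_cat /= -es -et -zprimitiveM -epq {1}[p]zpolyEprim cp scale1r.
Qed.

(* Hence hypotheses of the form [is_support P I] are never vacuous. *)
Lemma is_support_exists (P : {poly int}) : P != 0 -> exists I, is_support P I.
Proof.
move=> P0.
have [||s hs es] := @prime_factorization_seq (size P) (zprimitive P).
- by rewrite size_zprimitive.
- by rewrite zcontents_primitive P0.
exists [fset phi in s]%fset; split; first by move=> phi /[!inE] /hs.
exists (zcontents P), (fun phi => count_mem phi s); split.
- by rewrite zcontents_eq0.
- by move=> phi /[!inE]; rewrite -has_count has_pred1.
rewrite {1}[P]zpolyEprim mul_polyC es; congr (_ *: _).
rewrite -big_undup_iterop_count /=.
have sI : perm_eq [fset phi in s]%fset (undup s).
  by apply: uniq_perm; rewrite ?undup_uniq ?fset_uniq // => phi;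
    rewrite mem_undup !inE.
by rewrite (perm_big _ sI).
Qed.

(* Main.v *)
Require Import Defs.
From HB Require Import structures.
From mathcomp Require Import all_boot all_order all_algebra finmap.
From mathcomp Require Import all_classical all_reals all_analysis.
From mathcomp Require Import zify ring lra.

Set Implicit Arguments.
Unset Strict Implicit.
Unset Printing Implicit Defensive.

Import Order.TTheory GRing.Theory Num.Theory.
Local Open Scope ring_scope.

(** Let [C], [U], [V] be the products of the common support factors, of those
    occurring only in [F], and of those occurring only in [G].

    Necessity.  If [F] never vanishes modulo [m1] nor [G] modulo [m2], no
    multiple of [m1 * m2] ever divides a value, so the multiples form a set [A]
    without gaps ([gaps_unbounded_intersective]).  If [U * V] is not
    intersective, some prime power [p ^ k] divides none of its values; then the
    [p]-adic valuations of [F n] and [G n] are both linearly comparable with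
    that of [C n], and a lacunary set of powers of [p] does not separate them
    ([gaps_bounded_at_prime]).

    Sufficiency.  The idea is to pick [n] in a residue class that forces many
    elements of [A] to divide one of [F n], [G n], while the other one is almost
    prime.  This is possible by a lower bound sieve of Brun-Hooley type
    ([sieve]): for [H] nonzero and any class modulo an [N] divisible by all
    small primes, there are arbitrarily large [n] in the class such that the
    part of [H n] prime to [N] has a number of divisors bounded in terms of [H]
    only ([almost_prime_values]).  It remains to choose the class so that the
    part of [H n] composed of primes of [N] stays bounded as well.

    If [U] is intersective, take for [N] a multiple of many elements of [A] and
    a class of zeros of [U] modulo [N]: since [U] and [G] are coprime over the
    rationals, a common divisor of [U n] and [G n] divides a fixed integer
    ([gaps_of_intersective_part]).  The case of [V] is symmetric.

    In degree at most two, the only other possibility is that [C], [U] and [V]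
    are all linear, with [F] intersective up to symmetry.  Let [Q] be the set of
    primes dividing the leading coefficient of [U].  Modulo them [U] has no
    zero, hence [C] and [V] have zeros modulo all their powers, whereas [U] has
    zeros modulo every integer prime to [Q].  Splitting the elements of [A] into
    their [Q]-part and the rest, [gaps_of_triple] makes either [F n] or [G n]
    highly divisible, according to how these two parts are distributed. *)

(** * Truncated inclusion-exclusion *)

(** The [k]-th elementary symmetric function of the [x p], for [p] in [ps]. *)
Fixpoint elem_sym (R : pzRingType) (x : nat -> R) (k : nat) (ps : seq nat) : R :=
  if ps is p :: ps' then
    if k is k'.+1 then elem_sym x k ps' + x p * elem_sym x k' ps' else 1
  else (k == 0)%:R.

(** The alternating sum of the elementary symmetric functions of order at most
    [k], in the recursive form on which every later induction runs: a prime [p]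
    contributes by consuming one unit of [k]. *)
Fixpoint trunc_sum (R : pzRingType) (x : nat -> R) (k : nat) (ps : seq nat) : R :=
  if ps is p :: ps' then
    trunc_sum x k ps' - x p * (if k is k'.+1 then trunc_sum x k' ps' else 0)
  else 1.

Lemma elem_sym0 (R : pzRingType) (x : nat -> R) ps : elem_sym x 0 ps = 1.
Proof. by case: ps. Qed.

Lemma trunc_sumS (R : comPzRingType) (x : nat -> R) k ps :
  trunc_sum x k.+1 ps = trunc_sum x k ps + (-1) ^+ k.+1 * elem_sym x k.+1 ps.
Proof.
elim: ps k => [|p ps IH] k /=; first by rewrite mulr0 addr0.
case: k => [|k].
  rewrite IH elem_sym0 !expr1.
  have -> : trunc_sum x 0 ps = 1 by elim: ps {IH} => //= q ps ->; rewrite mulr0 subr0.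
  by rewrite mulr0 subr0; ring.
by rewrite !IH (exprS (-1) k.+1); ring.
Qed.

Lemma elem_sym_ge0 (R : numDomainType) (x : nat -> R) k ps :
  {in ps, forall p, 0 <= x p} -> 0 <= elem_sym x k ps.
Proof.
elim: ps k => [|p ps IH] k /= x0; first by rewrite ler0n.
have x0' : {in ps, forall q, 0 <= x q}.
  by move=> q qps; apply: x0; rewrite inE qps orbT.
case: k => [|k]; first by rewrite ler01.
by rewrite addr_ge0 ?mulr_ge0 ?IH // x0 // mem_head.
Qed.

(** The Bonferroni inequalities.  They hold for all real [x p] in the unit
    interval, so they serve both pointwise, where [x p] says whether [p] divides
    a value, and for densities. *)
Lemma trunc_sum_bonferroni (R : numDomainType) (x : nat -> R) k ps :
  {in ps, forall p, 0 <= x p <= 1} ->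
  if odd k then trunc_sum x k ps <= \prod_(p <- ps) (1 - x p)
  else \prod_(p <- ps) (1 - x p) <= trunc_sum x k ps.
Proof.
elim: ps k => [|p ps IH] k /= x01; first by rewrite big_nil; case: ifP.
have x01' : {in ps, forall q, 0 <= x q <= 1}.
  by move=> q qps; apply: x01; rewrite inE qps orbT.
have /andP[xp0 xp1] : 0 <= x p <= 1 by apply: x01; rewrite mem_head.
have P0 : 0 <= \prod_(q <- ps) (1 - x q).
  rewrite big_seq prodr_ge0 // => q qps; rewrite subr_ge0.
  by have /andP[] := x01' _ qps.
rewrite big_cons mulrBl mul1r.
case: k => [|k] /=.
  have := IH 0 x01'; rewrite /= mulr0 subr0; apply: le_trans.
  by rewrite gerBl mulr_ge0.
have := IH k.+1 x01'; have := IH k x01'; rewrite /=.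
by case: (odd k) => /= h1 h2; apply: lerB => //; apply: ler_wpM2l.
Qed.

Lemma exprD_ge_linear (R : realDomainType) (x s : R) k :
  0 <= x -> 0 <= s -> s ^+ k.+1 + k.+1%:R * x * s ^+ k <= (x + s) ^+ k.+1.
Proof.
move=> x0 s0; elim: k => [|k IH]; first by rewrite !expr1 expr0; lra.
rewrite [in leRHS]exprS.
have := ler_wpM2l (addr_ge0 x0 s0) IH; apply: le_trans.
rewrite !exprS -[in k.+2%:R]addn1 natrD.
have h : 0 <= x * x * s ^+ k by rewrite !mulr_ge0 // exprn_ge0.
have : 0 <= k.+1%:R * (x * x * s ^+ k) :> R by rewrite mulr_ge0 // ler0n.
by set c := k.+1%:R; set t := s ^+ k => h'; nra.
Qed.

Lemma elem_sym_le (R : realDomainType) (x : nat -> R) k ps :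
  {in ps, forall p, 0 <= x p} ->
  elem_sym x k ps * k`!%:R <= (\sum_(p <- ps) x p) ^+ k.
Proof.
elim: ps k => [|p ps IH] k /= x0.
  rewrite big_nil; case: k => [|k]; first by rewrite mul1r.
  by rewrite mul0r exprn_ge0.
have x0' : {in ps, forall q, 0 <= x q}.
  by move=> q qps; apply: x0; rewrite inE qps orbT.
have xp0 : 0 <= x p by apply: x0; rewrite mem_head.
case: k => [|k]; first by rewrite mul1r expr0.
have s0 : 0 <= \sum_(q <- ps) x q by rewrite big_seq sumr_ge0.
rewrite big_cons; apply: le_trans (exprD_ge_linear k xp0 s0).
rewrite mulrDl lerD ?IH //.
have c0 : 0 <= k.+1%:R * x p by rewrite mulr_ge0 // ler0n.
apply: le_trans (ler_wpM2l c0 (IH k x0')).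
by rewrite factS natrM le_eqVlt; apply/orP; left; apply/eqP; ring.
Qed.

(** * Counting sieved residues *)

Lemma modn_periodic (T : Type) (h : nat -> T) d :
  (forall t, h (t + d)%N = h t) -> forall t, h (t %% d)%N = h t.
Proof.
move=> hd t; rewrite [in RHS](divn_eq t d); elim: (t %/ d)%N => [|q IH].
  by rewrite mul0n.
by rewrite mulSn -addnA addnC hd.
Qed.

(** Conditions at coprime moduli are independent. *)
Lemma chinese_sum (R : comPzRingType) (f1 f2 : nat -> R) d1 d2 :
  (0 < d1)%N -> (0 < d2)%N -> coprime d1 d2 ->
  (forall t, f1 (t + d1)%N = f1 t) -> (forall t, f2 (t + d2)%N = f2 t) ->
  \sum_(t < d1 * d2) f1 t * f2 t = (\sum_(t < d1) f1 t) * (\sum_(t < d2) f2 t).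
Proof.
move=> d1p d2p co p1 p2; rewrite big_distrlr /= pair_big /=.
pose e (t : 'I_(d1 * d2)) : 'I_d1 * 'I_d2 :=
  (Ordinal (ltn_pmod t d1p), Ordinal (ltn_pmod t d2p)).
have einj : injective e.
  move=> s t [/eqP e1 /eqP e2]; apply/val_inj/eqP => /=.
  rewrite -(modn_small (ltn_ord s)) -(modn_small (ltn_ord t)).
  by rewrite chinese_remainder // e1.
have ebij : bijective e by apply: inj_card_bij; rewrite // card_prod !card_ord.
rewrite (reindex e); last exact: onW_bij.
by apply: eq_bigr => t _; rewrite /= !modn_periodic.
Qed.

Lemma sum_ge0_widen (R : numDomainType) (f : nat -> R) m n :
  (forall t, 0 <= f t) -> (m <= n)%N -> \sum_(t < m) f t <= \sum_(t < n) f t.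
Proof.
move=> f0 mn; rewrite -!(big_mkord xpredT f) [leRHS](@big_cat_nat _ _ _ m) //=.
by rewrite lerDl sumr_ge0.
Qed.

Lemma periodic_sum (R : comPzRingType) (f : nat -> R) d q s :
  (forall t, f (t + d)%N = f t) ->
  \sum_(t < q * d + s) f t = q%:R * (\sum_(t < d) f t) + \sum_(t < s) f t.
Proof.
move=> fd; rewrite -!(big_mkord xpredT f).
elim: q => [|q IH]; first by rewrite mul0r add0r.
rewrite mulSn -addnA (@big_cat_nat _ _ _ d) ?leq_addr //=.
have -> : \sum_(d <= i < d + (q * d + s)) f i = \sum_(0 <= i < q * d + s) f i.
  rewrite -{1}[d]add0n big_addn addKn; apply: eq_bigr => i _; exact: fd.
by rewrite IH -natr1; ring.
Qed.

(** Complete periods are counted exactly, and an incomplete one contributes at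
    most one more period. *)
Lemma periodic_average (R : realFieldType) (f : nat -> R) d T :
  (0 < d)%N -> (forall t, 0 <= f t) -> (forall t, f (t + d)%N = f t) ->
  `|\sum_(t < T) f t - T%:R * ((\sum_(t < d) f t) / d%:R)|
    <= \sum_(t < d) f t.
Proof.
move=> dp f0 fd; set r := \sum_(t < d) f t; have r0 : 0 <= r by apply: sumr_ge0.
have -> : \sum_(t < T) f t = (T %/ d)%:R * r + \sum_(t < T %% d) f t.
  rewrite -periodic_sum //.
  by rewrite -(big_mkord xpredT f) {1}(divn_eq T d) big_mkord.
have sr : \sum_(t < T %% d) f t <= r.
  by apply: sum_ge0_widen => //; rewrite ltnW // ltn_pmod.
have s0 : 0 <= \sum_(t < T %% d) f t by apply: sumr_ge0.
have d0 : 0 < d%:R :> R by rewrite ltr0n.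
have -> : T%:R * (r / d%:R) =
    (T %/ d)%:R * r + (T %% d)%:R / d%:R * r :> R.
  rewrite [in T%:R](divn_eq T d) natrD natrM; field; exact: lt0r_neq0.
set u := (T %% d)%:R / d%:R.
have u0 : 0 <= u by rewrite divr_ge0 // ler0n.
have u1 : u <= 1 by rewrite ler_pdivrMr // mul1r ler_nat ltnW // ltn_pmod.
by rewrite ler_norml; apply/andP; split; nra.
Qed.

Definition hit_at (R : pzRingType) (hit : nat -> nat -> bool) (t p : nat) : R :=
  (hit p t)%:R.

Definition hit_density (R : fieldType) (hit : nat -> nat -> bool) (p : nat) : R :=
  (\sum_(t < p) (hit p t)%:R) / p%:R.

(** Deviation of the sum of [Phi] over the [t < T] hit by all primes of [S] from
    the value predicted by independence.  Carrying the extra set [S]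
    is what makes the estimate stable under multiplication by new primes. *)
Definition avg_error (R : realFieldType) hit T (Phi : (nat -> R) -> R)
    (S : seq nat) : R :=
  `|\sum_(t < T) Phi (hit_at R hit t) * \prod_(p <- S) hit_at R hit t p
    - T%:R * (Phi (hit_density R hit) * \prod_(p <- S) hit_density R hit p)|.

Definition averages (R : realFieldType) hit kap T y z (Phi : (nat -> R) -> R)
    (N : R) :=
  forall S : seq nat, uniq S ->
    {in S, forall p, prime p /\ (y < p <= z)%N} ->
    avg_error hit T Phi S <= N * kap%:R ^+ size S.

Definition sieving_system (hit : nat -> nat -> bool) (kap y : nat) :=
  forall p, prime p -> (y < p)%N ->
    (forall t, hit p (t + p)%N = hit p t) /\
    (\sum_(t < p) hit p t <= kap)%N.

(** The base case is the Chinese remainder theorem. *)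
Lemma averages1 (R : realFieldType) hit kap T y z :
  sieving_system hit kap y -> averages hit kap T y z (fun=> 1 : R) 1.
Proof.
move=> hs S uS Sp; rewrite /avg_error mul1r.
pose f S t : R := \prod_(p <- S) hit_at R hit t p.
pose d S := (\prod_(p <- S) p)%N.
suff [dp fd fr ->] : [/\ (0 < d S)%N, forall t, f S (t + d S)%N = f S t,
    \sum_(t < d S) f S t <= kap%:R ^+ size S
  & \prod_(p <- S) hit_density R hit p = (\sum_(t < d S) f S t) / (d S)%:R].
  under eq_bigr do rewrite mul1r.
  rewrite mul1r; apply: le_trans fr; apply: periodic_average => // t.
  by apply: prodr_ge0 => p _; rewrite ler0n.
elim: S uS Sp => [|p S IH] /=.
  move=> _ _; rewrite /d /f !big_nil; split => //; first by move=> t; rewrite !big_nil.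
    by rewrite big_ord1 big_nil expr0.
  by rewrite big_ord1 big_nil divr1.
case/andP=> pS uS Sp.
have [pp /andP[yp _]] := Sp p (mem_head _ _).
have [hper hcard] := hs p pp yp.
have [||dp fd fr fE] := IH; first by [].
  by move=> q qS; apply: Sp; rewrite inE qS orbT.
have p0 : (0 < p)%N by exact: prime_gt0.
have co : coprime p (d S).
  rewrite /d big_seq; apply: (big_ind (coprime p)).
  - exact: coprimen1.
  - by move=> a b; rewrite coprimeMr => -> ->.
  move=> q qS; have [pq _] : prime q /\ (y < q <= z)%N.
    by apply: Sp; rewrite inE qS orbT.
  by rewrite prime_coprime // dvdn_prime2 //; apply: contraNneq pS => ->.
have fS t : f (p :: S) t = (hit p t)%:R * f S t by rewrite /f big_cons.
have dS : d (p :: S) = (p * d S)%N by rewrite /d big_cons.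
have hper' t : (hit p (t + p)%N)%:R = (hit p t)%:R :> R by rewrite hper.
have sE : \sum_(t < d (p :: S)) f (p :: S) t =
    (\sum_(t < p) (hit p t)%:R) * (\sum_(t < d S) f S t).
  rewrite dS; under eq_bigr do rewrite fS.
  exact: (@chinese_sum R (fun t => (hit p t)%:R) (f S)).
split.
- by rewrite dS muln_gt0 p0.
- move=> t; rewrite !fS dS; congr (_%:R * _).
    by rewrite -(modn_periodic hper) addnC mulnC modnMDl (modn_periodic hper).
  by rewrite -(modn_periodic fd) addnC modnMDl (modn_periodic fd).
- rewrite sE exprS; apply: ler_pM => //; try by apply: sumr_ge0 => t _; rewrite ler0n.
    by apply: sumr_ge0 => t _; apply: prodr_ge0 => q _; rewrite ler0n.
  by rewrite -natr_sum ler_nat.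
- rewrite sE big_cons fE dS natrM /hit_density; field.
  by rewrite !pnatr_eq0 -!lt0n p0 dp.
Qed.

Lemma avg_errorD (R : realFieldType) hit T (A B : (nat -> R) -> R) c p S :
  avg_error hit T (fun x => A x + c * (x p * B x)) S <=
  avg_error hit T A S + `|c| * avg_error hit T B (p :: S).
Proof.
rewrite /avg_error -normrM; apply: le_trans (ler_normD _ _).
rewrite le_eqVlt; apply/orP; left; apply/eqP; congr `|_|.
rewrite mulrBr mulr_sumr big_cons.
have -> : \sum_(t < T) (A (hit_at R hit t) +
      c * (hit_at R hit t p * B (hit_at R hit t))) *
      \prod_(q <- S) hit_at R hit t q =
    \sum_(t < T) A (hit_at R hit t) * \prod_(q <- S) hit_at R hit t q +
    \sum_(t < T) c * (B (hit_at R hit t) * \prod_(q <- p :: S) hit_at R hit t q).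
  rewrite -big_split; apply: eq_bigr => t _ /=; rewrite big_cons; ring.
ring.
Qed.

(** Multiplying by a truncated sum over the primes of one block inflates the
    error at most by the number of monomials, each weighted by [kap] to the power
    of its degree. *)
Lemma averages_block (R : realFieldType) hit kap T y z0 z1
    (Phi : (nat -> R) -> R) (N : R) (ps : seq nat) k :
  0 <= N -> (z0 <= z1)%N -> (y <= z0)%N ->
  averages hit kap T y z1 Phi N ->
  uniq ps -> {in ps, forall p, prime p /\ (z0 < p <= z1)%N} ->
  let N' := (1 + kap%:R * (size ps)%:R) ^+ k * N in
  averages hit kap T y z0 (fun x => trunc_sum x k ps * Phi x) N' /\
  averages hit kap T y z0 (fun x => elem_sym x k ps * Phi x) N'.
Proof.
move=> N0 z01 yz hPhi ups hps N'.
pose good S := uniq S /\ {in S, forall p, prime p /\ (y < p <= z1)%N}.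
suff H : forall S, good S -> ~~ has (mem ps) S ->
    avg_error hit T (fun x => trunc_sum x k ps * Phi x) S
      <= N' * kap%:R ^+ size S /\
    avg_error hit T (fun x => elem_sym x k ps * Phi x) S
      <= N' * kap%:R ^+ size S.
  have good' S : uniq S -> {in S, forall p, prime p /\ (y < p <= z0)%N} ->
      good S /\ ~~ has (mem ps) S.
    move=> uS Sp; split; first split => // p pS.
      by have [? /andP[-> h]] := Sp p pS; split => //; apply: leq_trans h z01.
    apply/hasPn => p pS; apply/negP => /= /hps [_ /andP[h _]].
    by have [_ /andP[_]] := Sp p pS; rewrite leqNgt h.
  by split=> S uS Sp; have [g1 g2] := good' S uS Sp; have [] := H S g1 g2.
rewrite {}/N'; elim: ps ups hps k => [|p ps IH] /=.
  move=> _ _ k S [uS Sp] _; rewrite mulr0 addr0 expr1n mul1r.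
  have h := hPhi S uS Sp; split.
    by rewrite (_ : (fun x => 1 * Phi x) = Phi) //; apply/funext => x; rewrite mul1r.
  case: k => [|k] /=.
    by rewrite (_ : (fun x => 1 * Phi x) = Phi) //; apply/funext => x; rewrite mul1r.
  rewrite /avg_error big1 => [|t _]; last by rewrite !mul0r.
  by rewrite !mul0r mulr0 subrr normr0 mulr_ge0 // exprn_ge0.
case/andP=> pps ups hps k S gS; rewrite -/(has _ _) => nS.
have [pp /andP[zp pz]] := hps p (mem_head _ _).
have hps' : {in ps, forall p, prime p /\ (z0 < p <= z1)%N}.
  by move=> q qps; apply: hps; rewrite inE qps orbT.
have nS' : ~~ has (mem ps) S.
  by apply: contra nS; apply: sub_has => q /= qps; rewrite inE qps orbT.
have pS : p \notin S.
  by apply/negP => pS; case/hasP: nS; exists p => //; exact: mem_head.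
have gpS : good (p :: S).
  have [uS Sp] := gS; split; first by rewrite /= pS.
  move=> q; rewrite inE => /orP[/eqP ->|/Sp //]; split => //.
  by rewrite pz (leq_ltn_trans yz zp).
have npS : ~~ has (mem ps) (p :: S) by rewrite /= negb_or pps.
set a := 1 + kap%:R * (size ps)%:R : R.
have a1 : 1 <= a by rewrite lerDl mulr_ge0 ?ler0n.
have -> : 1 + kap%:R * (size ps).+1%:R = a + kap%:R :> R.
  by rewrite /a -[in _.+1%:R]addn1 natrD; ring.
have K0 : 0 <= kap%:R ^+ size S * N by rewrite mulr_ge0 // exprn_ge0.
have kap0 : 0 <= kap%:R :> R by rewrite ler0n.
case: k => [|k].
  have [h1 h2] := IH ups hps' 0 S gS nS'.
  split.
    rewrite (_ : (fun x => _) = (fun x => trunc_sum x 0 ps * Phi x)) //.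
    by apply/funext => x; rewrite mulr0 subr0.
  rewrite (_ : (fun x => _) = (fun x => elem_sym x 0 ps * Phi x)) //.
  by apply/funext => x; rewrite elem_sym0.
have [h1 h2] := IH ups hps' k.+1 S gS nS'.
have [h3 h4] := IH ups hps' k (p :: S) gpS npS.
have le : (a ^+ k.+1 * N * kap%:R ^+ size S) +
    (a ^+ k * N * kap%:R ^+ size (p :: S))
    <= (a + kap%:R) ^+ k.+1 * N * kap%:R ^+ size S.
  have -> : (a ^+ k.+1 * N * kap%:R ^+ size S) +
      (a ^+ k * N * kap%:R ^+ size (p :: S)) =
      (a ^+ k * (a + kap%:R)) * (kap%:R ^+ size S * N).
    by rewrite /= !exprS; ring.
  rewrite -[leRHS]mulrA [N * _]mulrC ler_wpM2r // exprSr ler_wpM2r //.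
    by lra.
  by apply: lerXn2r; rewrite ?nnegrE; lra.
split; apply: le_trans le.
- rewrite (_ : (fun x => _) = (fun x => trunc_sum x k.+1 ps * Phi x +
      (-1) * (x p * (trunc_sum x k ps * Phi x)))); last first.
    by apply/funext => x; ring.
  by apply: le_trans (avg_errorD _ _ _ _ _ _ _) _; rewrite normrN1 mul1r lerD.
rewrite (_ : (fun x => _) = (fun x => elem_sym x k.+1 ps * Phi x +
    1 * (x p * (elem_sym x k ps * Phi x)))); last first.
  by apply/funext => x; ring.
by apply: le_trans (avg_errorD _ _ _ _ _ _ _) _; rewrite normr1 mul1r lerD.
Qed.

(** * The primes of a block *)

(** Blocks [(2 ^ m, 2 ^ (2 m)]] have a bounded sum of reciprocals of primes,
    whatever [m] is, while doubling [m] leads to the next block. *)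
Definition block m := [seq p <- index_iota (2 ^ m).+1 (2 ^ (2 * m)).+1 | prime p].

Lemma mem_block m p : (p \in block m) = prime p && (2 ^ m < p <= 2 ^ (2 * m))%N.
Proof. by rewrite mem_filter mem_index_iota ltnS. Qed.

Lemma prod_primes_dvdn (ps : seq nat) n :
  uniq ps -> {in ps, forall p, prime p /\ (p %| n)%N} ->
  (\prod_(p <- ps) p %| n)%N.
Proof.
elim: ps => [|p ps IH] /=; first by rewrite big_nil dvd1n.
case/andP=> pps ups hps; rewrite big_cons Gauss_dvd.
  have [_ ->] := hps p (mem_head _ _); rewrite IH // => q qps.
  by apply: hps; rewrite inE qps orbT.
have [pp _] := hps p (mem_head _ _).
rewrite big_seq; apply: (big_ind (coprime p)).
- exact: coprimen1.
- by move=> a b; rewrite coprimeMr => -> ->.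
move=> q qS; have [pq _] : prime q /\ (q %| n)%N by apply: hps; rewrite inE qS orbT.
by rewrite prime_coprime // dvdn_prime2 //; apply: contraNneq pps => ->.
Qed.

Lemma central_bin_le n : ('C(2 * n, n) <= 4 ^ n)%N.
Proof.
have -> : (4 ^ n = \sum_(i < (2 * n).+1) 'C(2 * n, i))%N.
  rewrite -[4%N]/(2 ^ 2)%N -expnM.
  rewrite -[X in (X ^ _)%N]/(1 + 1)%N Pascal.
  by apply: eq_bigr => j _; rewrite !exp1n !muln1.
have lt : (n < (2 * n).+1)%N by rewrite ltnS leq_pmull.
by rewrite (bigD1 (Ordinal lt)) //= leq_addr.
Qed.

(** Every prime of the interval divides the binomial coefficient of [2 ^ i] in
    [2 ^ i.+1], which is at most [4 ^ (2 ^ i)]. *)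
Lemma count_primes_dyadic i :
  (i * count prime (index_iota (2 ^ i).+1 (2 ^ i.+1).+1) <= 2 ^ i.+1)%N.
Proof.
set ps := [seq p <- index_iota (2 ^ i).+1 (2 ^ i.+1).+1 | prime p].
rewrite -size_filter -/ps -(@leq_exp2l 2) //.
have psP p : p \in ps -> prime p /\ (2 ^ i < p <= 2 * 2 ^ i)%N.
  by rewrite mem_filter mem_index_iota ltnS -expnS => /andP[].
have dv : (\prod_(p <- ps) p %| 'C(2 * 2 ^ i, 2 ^ i))%N.
  apply: prod_primes_dvdn; first by rewrite filter_uniq // iota_uniq.
  move=> p /psP[pp /andP[lp gp]]; split => //.
  have := bin_fact (leq_pmull (2 ^ i) (isT : 0 < 2)%N).
  have -> : (2 * 2 ^ i - 2 ^ i = 2 ^ i)%N by rewrite mul2n -addnn addnK.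
  have nf : ~~ (p %| (2 ^ i)`!)%N.
    apply/negP => h; have := lp; rewrite ltnNge => /negP; apply.
    move: h; rewrite fact_prod big_seq; elim/big_ind: _ => //.
    - by rewrite Euclid_dvd1.
    - by move=> a b ha hb; rewrite Euclid_dvdM // => /orP[/ha|/hb].
    move=> j; rewrite mem_index_iota ltnS => /andP[j0 jn] /dvdn_leq h.
    exact: leq_trans (h j0) jn.
  move=> E; have : (p %| (2 * 2 ^ i)`!)%N.
    by apply: dvdn_fact; rewrite gp prime_gt0.
  by rewrite -E !Euclid_dvdM // (negPf nf) !orbF.
have := leq_trans (dvdn_leq _ dv) (central_bin_le _).
rewrite bin_gt0 leq_pmull // => /(_ isT).
have -> : (4 ^ (2 ^ i) = 2 ^ (2 ^ i.+1))%N by rewrite expnS (expnM 2 2).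
apply: leq_trans; rewrite expnM.
have -> : ((2 ^ i) ^ size ps = \prod_(p <- ps) 2 ^ i)%N.
  by elim: (ps) => [|p s IH]; rewrite ?big_nil // big_cons -IH expnS.
by rewrite big_seq [leqRHS]big_seq; apply: leq_prod => p /psP[_ /andP[/ltnW]].
Qed.

(** Chebyshev's bound gives [2 / i] for the primes between [2 ^ i] and
    [2 ^ i.+1], and a block consists of [m] such dyadic intervals with
    [m <= i]. *)
Lemma sum_block_inv (R : realFieldType) m :
  (0 < m)%N -> \sum_(p <- block m) p%:R^-1 <= 2 :> R.
Proof.
move=> m0; pose S a : R :=
  \sum_((2 ^ m).+1 <= p < (2 ^ (m + a)).+1 | prime p) p%:R^-1.
suff H a : S a <= a%:R * (2 / m%:R).
  rewrite big_filter; have := H m; rewrite /S addnn -mul2n.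
  by rewrite mulrCA divff ?mulr1 // pnatr_eq0 -lt0n.
elim: a => [|a IH]; first by rewrite /S addn0 big_geq // mul0r.
have le1 : ((2 ^ m).+1 <= (2 ^ (m + a)).+1)%N by rewrite ltnS leq_exp2l ?leq_addr.
have le2 : ((2 ^ (m + a)).+1 <= (2 ^ (m + a.+1)).+1)%N.
  by rewrite ltnS leq_exp2l ?leq_add2l.
rewrite /S (big_cat_nat le1 le2) /= -/(S a) -natr1 mulrDl mul1r lerD //.
set i := (m + a)%N; rewrite addnS -/i.
have i0 : (0 < i)%N by rewrite addn_gt0 m0.
have pi0 : 0 < (2 ^ i)%:R :> R by rewrite ltr0n expn_gt0.
have := count_primes_dyadic i; set n := count _ _ => hn.
apply: (@le_trans _ _ (n%:R * (2 ^ i)%:R^-1)).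
  rewrite /n -[count _ _]sum1_count natr_sum mulr_suml.
  rewrite big_seq_cond [leRHS]big_seq_cond; apply: ler_sum => p.
  rewrite mem_index_iota => /andP[/andP[lp _] _]; rewrite mul1r.
  by rewrite lef_pV2 ?posrE ?ler_nat ?(ltnW lp) // ltr0n (leq_trans _ lp).
rewrite ler_pdivrMr // mulrAC ler_pdivlMr ?ltr0n // -!natrM ler_nat -expnS.
apply: leq_trans hn; rewrite mulnC leq_mul2r; apply/orP; right.
exact: leq_addr.
Qed.

(** * The sieve *)

(** A truncated inclusion-exclusion on each of [J] successive blocks.  The
    largest block is truncated at order [2 b] and each smaller block two orders
    later: the truncation errors then sum geometrically, and the sizes of the
    moduli remain bounded by a power of the largest prime. *)
Fixpoint upper_sieve (R : pzRingType) (x : nat -> R) b J m : R :=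
  if J is J'.+1 then
    trunc_sum x (2 * (b + J')) (block m) * upper_sieve x b J' (2 * m)
  else 1.

(** Hooley's lower bound: the product of the upper truncations exceeds the
    indicator of the unsieved set by at most one correction term per block. *)
Fixpoint lower_sieve (R : pzRingType) (x : nat -> R) b J m : R :=
  if J is J'.+1 then
    trunc_sum x (2 * (b + J')) (block m) * lower_sieve x b J' (2 * m)
    - elem_sym x (2 * (b + J')).+1 (block m) * upper_sieve x b J' (2 * m)
  else 1.

Fixpoint unsieved (R : pzRingType) (x : nat -> R) J m : R :=
  if J is J'.+1 then (\prod_(p <- block m) (1 - x p)) * unsieved x J' (2 * m)
  else 1.

(** By induction on the blocks: if [t] and [e] denote the truncated sum and the
    next elementary symmetric function of a block, then [t - e <= P <= t] for the
    full product [P] over the block. *)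
Lemma sieve_bounds (R : realDomainType) (x : nat -> R) b J m :
  (forall p, 0 <= x p <= 1) ->
  [/\ 0 <= unsieved x J m, unsieved x J m <= upper_sieve x b J m
    & lower_sieve x b J m <= unsieved x J m].
Proof.
move=> x01; elim: J m => [|J IH] m /=; first by rewrite ler01.
have [u0 uU Lu] := IH (2 * m)%N.
have P0 : 0 <= \prod_(p <- block m) (1 - x p).
  by apply: prodr_ge0 => p _; rewrite subr_ge0; case/andP: (x01 p).
have x01' : {in block m, forall p, 0 <= x p <= 1} by move=> p _.
have := trunc_sum_bonferroni (2 * (b + J)) x01'.
have := trunc_sum_bonferroni (2 * (b + J)).+1 x01'.
have e0 : 0 <= elem_sym x (2 * (b + J)).+1 (block m).
  by apply: elem_sym_ge0 => p _; case/andP: (x01 p).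
rewrite trunc_sumS /= oddM /= -signr_odd /= oddM /= expr1 mulN1r => lo hi.
have t0 := le_trans P0 hi.
split; first exact: mulr_ge0.
  by apply: ler_pM.
have h1 := ler_wpM2l t0 Lu; have h2 := ler_wpM2l e0 uU.
by have h3 := ler_wpM2r u0 lo; rewrite mulrBl in h3; lra.
Qed.

Lemma unsieved_gt0 (R : realDomainType) (x : nat -> R) J m p :
  (0 < m)%N -> (forall p, 0 <= x p <= 1) -> unsieved x J m != 0 ->
  prime p -> (2 ^ m < p <= 2 ^ (m * 2 ^ J))%N -> x p != 1.
Proof.
move=> m0 x01; elim: J m m0 => [|J IH] m m0 /=.
  by rewrite muln1 => _ _ /andP[h1 h2]; have := leq_trans h1 h2; rewrite ltnn.
rewrite mulf_eq0 negb_or => /andP[n1 n2] pp /andP[lp up].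
have [pm|pm] := leqP p (2 ^ (2 * m)).
  apply: contraNneq n1 => xp; apply/eqP.
  have pb : p \in block m by rewrite mem_block pp lp.
  by rewrite (big_rem p) //= xp subrr mul0r.
apply: (IH (2 * m)%N) => //; first by rewrite muln_gt0.
by rewrite pm /=; move: up; rewrite expnS mulnCA mulnA.
Qed.

Lemma averagesW (R : realFieldType) hit kap T y z (Phi : (nat -> R) -> R) N N' :
  N <= N' -> averages hit kap T y z Phi N -> averages hit kap T y z Phi N'.
Proof.
move=> NN h S uS Sp; apply: le_trans (h S uS Sp) _.
by rewrite ler_wpM2r // exprn_ge0.
Qed.

Lemma averagesB (R : realFieldType) hit kap T y z (A B : (nat -> R) -> R) M N :
  averages hit kap T y z A M -> averages hit kap T y z B N ->
  averages hit kap T y z (fun x => A x - B x) (M + N).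
Proof.
move=> hA hB S uS Sp; rewrite mulrDl.
apply: le_trans (lerD (hA S uS Sp) (hB S uS Sp)).
rewrite /avg_error; apply: le_trans (ler_normB _ _).
rewrite le_eqVlt; apply/orP; left; apply/eqP; congr `|_|.
rewrite [X in X - _ = _](_ : _ =
    \sum_(t < T) A (hit_at R hit t) * \prod_(p <- S) hit_at R hit t p -
    \sum_(t < T) B (hit_at R hit t) * \prod_(p <- S) hit_at R hit t p).
  by ring.
by rewrite -sumrB; apply: eq_bigr => t _; rewrite mulrBl.
Qed.

(** Exponent of the error in base [2 ^ m]. *)
Fixpoint error_exponent b J : nat :=
  if J is J'.+1 then (2 * error_exponent b J' + 4 * (2 * (b + J')).+1)%N else 0.

(** The recursion doubles [error_exponent b J + 8 J + 8 b + 12]. *)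
Lemma error_exponent_le b J : (error_exponent b J <= 2 ^ J * (8 * b + 12))%N.
Proof.
suff : (error_exponent b J + 8 * J + (8 * b + 12) = 2 ^ J * (8 * b + 12))%N by lia.
elim: J => [|J IH] /=; first by rewrite mul1n.
by rewrite expnS -mulnA -IH; lia.
Qed.

(** The averages have their expected values up to an error which, for fixed [b],
    is polynomial in the largest prime [2 ^ (m * 2 ^ J)]. *)
Lemma averages_sieve (R : realFieldType) hit kap T y b J m :
  sieving_system hit kap y -> (0 < m)%N -> (y <= 2 ^ m)%N -> (kap < 2 ^ m)%N ->
  let N := (2 ^ (m * error_exponent b J))%:R in
  averages hit kap T y (2 ^ m) (fun x : nat -> R => upper_sieve x b J m) N /\
  averages hit kap T y (2 ^ m) (fun x : nat -> R => lower_sieve x b J m) N.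
Proof.
move=> hs; elim: J m => [|J IH] m m0 ym km N.
  by rewrite /N muln0 /=; split; apply: averages1.
have m2 : (2 ^ m <= 2 ^ (2 * m))%N by rewrite leq_exp2l // leq_pmull.
have [||| hU hL] := IH (2 * m)%N.
- by rewrite muln_gt0.
- exact: leq_trans m2.
- exact: leq_trans m2.
set N1 := (2 ^ (2 * m * error_exponent b J))%:R in hU hL.
set a : R := 1 + kap%:R * (size (block m))%:R.
have N10 : 0 <= N1 by rewrite ler0n.
have ub : uniq (block m) by rewrite filter_uniq // iota_uniq.
have pb : {in block m, forall p, prime p /\ (2 ^ m < p <= 2 ^ (2 * m))%N}.
  by move=> p; rewrite mem_block => /andP[].
have blk Phi k h := @averages_block R hit kap T y _ _ Phi N1 (block m) k N10 m2
  ym h ub pb.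
have a1 : 1 <= a by rewrite lerDl mulr_ge0 // ler0n.
have bnd : a ^+ (2 * (b + J)).+1 * N1 <= N / 2.
  rewrite ler_pdivlMr //.
  have ha : a <= (2 ^ (3 * m))%:R.
    have sz : (size (block m) <= 2 ^ (2 * m))%N.
      rewrite size_filter; apply: leq_trans (count_size _ _) _.
      by rewrite size_iota subSS leq_subr.
    rewrite /a -natrM addrC natr1 ler_nat.
    have : (kap * size (block m) <= kap * 2 ^ (2 * m))%N by rewrite leq_mul2l sz orbT.
    have -> : (2 ^ (3 * m) = 2 ^ m * 2 ^ (2 * m))%N.
      by rewrite -expnD; congr (_ ^ _)%N; lia.
    have := expn_gt0 2 (2 * m).
    have : (kap.+1 * 2 ^ (2 * m) <= 2 ^ m * 2 ^ (2 * m))%N by rewrite leq_mul2r km orbT.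
    by rewrite mulSn; lia.
  have hk : a ^+ (2 * (b + J)).+1 <= (2 ^ (3 * m * (2 * (b + J)).+1))%:R.
    by rewrite expnM natrX; apply: lerXn2r; rewrite ?nnegrE ?(le_trans ler01 a1) ?ler0n.
  have := ler_wpM2r N10 hk => /(ler_wpM2r (ler0n R 2)) h; apply: le_trans h _.
  rewrite -!natrM ler_nat -expnD -expnSr leq_exp2l //=; nia.
have a0 : a ^+ (2 * (b + J)) * N1 <= N / 2.
  by apply: le_trans bnd; rewrite ler_wpM2r // exprS ler_peMl // exprn_ge0 //; lra.
have N0 : 0 <= N by rewrite ler0n.
have [hU1 _] := blk _ (2 * (b + J))%N hU.
have [hL1 _] := blk _ (2 * (b + J))%N hL.
have [_ hU2] := blk _ (2 * (b + J)).+1 hU.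
split; first by apply: averagesW hU1; lra.
have := averagesB (averagesW a0 hL1) (averagesW bnd hU2).
by rewrite -splitr.
Qed.

Lemma prod_onem_ge (R : realType) (x : nat -> R) ps :
  {in ps, forall p, 0 <= x p <= 1 / 2} ->
  expR (- (2 * \sum_(p <- ps) x p)) <= \prod_(p <- ps) (1 - x p).
Proof.
elim: ps => [|p ps IH] hx; first by rewrite !big_nil mulr0 oppr0 expR0.
have /andP[x0 x1] := hx p (mem_head _ _).
rewrite !big_cons mulrDr opprD expRD ler_pM ?expR_ge0 ?IH //; last first.
  by move=> q qps; apply: hx; rewrite inE qps orbT.
rewrite expRN invf_ple ?posrE ?expR_gt0 //; last by lra.
apply: le_trans (expR_ge1Dx _).
rewrite -div1r ler_pdivrMr; last by lra.
nra.
Qed.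

(** If each correction term is small against the corresponding block, the main
    term of the lower bound keeps half of the main term of the upper bound.  The
    factor [1 / 2 + 2 ^- (J + 1)] is what the induction can afford to lose. *)
Lemma lower_sieve_ge_upper (R : realFieldType) (x : nat -> R) b J m (w : R) :
  (forall p, 0 <= x p <= 1) -> (0 < m)%N -> 0 < w ->
  (forall m', (m <= m')%N -> w <= \prod_(p <- block m') (1 - x p)) ->
  (forall m' j, (m <= m')%N ->
     elem_sym x (2 * (b + j)).+1 (block m') <= w * 2^-1 ^+ j.+2) ->
  w ^+ J <= upper_sieve x b J m /\
  (1 / 2 + 2^-1 ^+ J.+1) * upper_sieve x b J m <= lower_sieve x b J m.
Proof.
move=> x01; elim: J m => [|J IH] m m0 w0 hw he /=.
  by rewrite expr0; split => //; lra.
have le2 m' : (2 * m <= m' -> m <= m')%N by lia.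
have [||||hU hL] := IH (2 * m)%N => //; first by rewrite muln_gt0.
- by move=> m' /le2; apply: hw.
- by move=> m' j /le2; apply: he.
have x01' : {in block m, forall p, 0 <= x p <= 1} by move=> p _.
have t1 := trunc_sum_bonferroni (2 * (b + J)) x01'.
rewrite oddM /= in t1.
set t := trunc_sum _ _ _ in t1 *.
have tw : w <= t by apply: le_trans (hw m (leqnn m)) t1.
have eh := he m J (leqnn m).
set e := elem_sym _ _ _ in eh *.
set U := upper_sieve _ _ _ _ in hU hL *.
set L := lower_sieve _ _ _ _ in hL *.
have U0 : 0 <= U by apply: le_trans hU; rewrite exprn_ge0 // ltW.
split; first by rewrite exprS ler_pM // ?ltW // exprn_gt0.
set d := 2^-1 ^+ J.+2 in eh *.
have dE : 2^-1 ^+ J.+1 = 2 * d :> R by rewrite /d [in RHS]exprS; field.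
rewrite dE in hL.
have d0 : 0 <= d by rewrite exprn_ge0 // invr_ge0.
have h1 : e <= t * d by apply: le_trans eh _; rewrite ler_wpM2r.
have h2 := ler_wpM2r U0 h1.
have h3 := ler_wpM2l (le_trans (ltW w0) tw) hL.
by lra.
Qed.

(** Factorials beat powers: the terms of the exponential series tend to [0]. *)
Lemma exp_coeff_small (R : realType) (x e : R) :
  0 < e -> exists b, forall n, (b <= n)%N -> x ^+ n / n`!%:R <= e.
Proof.
move=> e0; have /cvgrPdist_lt /(_ e e0) [b _ hb] := @cvg_exp_coeff R x.
exists b => n /hb /=; rewrite sub0r normrN => h.
by apply: ltW; apply: le_lt_trans h; apply: ler_norm.
Qed.

(** If every prime between [2 ^ m] and [2 ^ (m * 2 ^ J)] excludes at most [kap]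
    classes, some [t] of polynomial size in the largest prime avoids them all.
    The point is that [C] depends on [kap] alone.  The main term of the average
    of the lower sieve is at least [w ^ J / 2], where [w] bounds the density of
    each block from below, and it outweighs the error as soon as [C] is large. *)
Theorem sieve (R : realType) kap : exists C, forall m J hit,
  (0 < m)%N -> (2 * kap < 2 ^ m)%N -> sieving_system hit kap (2 ^ m) ->
  exists2 t, (t < 2 ^ (C * m * 2 ^ J))%N &
    forall p, prime p -> (2 ^ m < p <= 2 ^ (m * 2 ^ J))%N -> ~~ hit p t.
Proof.
pose w : R := expR (- (2 * (2 * kap%:R))).
have w0 : 0 < w by apply: expR_gt0.
have [b hb] := @exp_coeff_small R (4 * kap%:R) (w / 2) (divr_gt0 w0 (ltr0n R 2)).
have [c hc] : exists c : nat, 1 <= w * (2 ^ c)%:R.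
  have hi : 0 <= w^-1 by rewrite invr_ge0 ltW.
  exists (Num.bound w^-1); have := archi_boundP hi; set n := Num.bound _ => hn.
  rewrite -ler_pdivrMl // mulr1 (le_trans (ltW hn)) // ler_nat.
  exact: ltnW (ltn_expl n _).
exists (8 * b + 12 + c + 2)%N => m J hit m0 km hs.
set T := (2 ^ _)%N.
(* densities are needed in the range of the sieve only *)
pose hit' p t := [&& prime p, (2 ^ m < p)%N & hit p t].
have hs' : sieving_system hit' kap (2 ^ m).
  move=> p pp lp; have [h1 h2] := hs p pp lp.
  by split; rewrite /hit' pp lp.
pose g := hit_density R hit'.
have g0 p : 0 <= g p by rewrite divr_ge0 ?ler0n // sumr_ge0.
have gP p : g p <= kap%:R / p%:R.
  rewrite ler_wpM2r ?invr_ge0 ?ler0n // -natr_sum ler_nat.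
  have [/andP[pp lp]|np] := boolP (prime p && (2 ^ m < p)%N).
    by have [] := hs' p pp lp.
  by rewrite big1 // => t _; rewrite /hit' andbA (negPf np).
have g12 p : 0 <= g p <= 1 / 2.
  rewrite g0 /=; have [/andP[pp lp]|np] := boolP (prime p && (2 ^ m < p)%N).
    apply: le_trans (gP p) _; rewrite ler_pdivrMr ?ltr0n ?prime_gt0 //.
    have : (2 * kap <= p)%N by rewrite ltnW // (ltn_trans km).
    by rewrite -(ler_nat R) natrM; lra.
  rewrite /g /hit_density big1 ?mul0r ?divr_ge0 // => t _.
  by rewrite /hit' andbA (negPf np).
have g01 p : 0 <= g p <= 1 by have := g12 p; lra.
have gsum m' : (m <= m')%N -> \sum_(p <- block m') g p <= 2 * kap%:R.
  move=> mm; apply: (@le_trans _ _ (\sum_(p <- block m') kap%:R * p%:R^-1)).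
    by apply: ler_sum => p _; apply: gP.
  rewrite -mulr_sumr mulrC ler_wpM2r ?ler0n //.
  exact: sum_block_inv (leq_trans m0 mm).
have [||hwJ hLU] := @lower_sieve_ge_upper R g b J m w g01 m0 w0.
- move=> m' mm; apply: le_trans (prod_onem_ge _) => //.
  by rewrite ler_expR lerN2 ler_wpM2l ?gsum.
- move=> m' j mm; set n := (2 * (b + j)).+1.
  have f0 : 0 < n`!%:R :> R by rewrite ltr0n fact_gt0.
  have := elem_sym_le n (fun p (_ : p \in block m') => g0 p).
  rewrite -ler_pdivlMr // => /le_trans; apply.
  have sg0 : 0 <= \sum_(p <- block m') g p by apply: sumr_ge0.
  apply: (@le_trans _ _ ((2 * kap%:R) ^+ n / n`!%:R)).
    rewrite ler_wpM2r ?invr_ge0 ?ler0n //.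
    by apply: lerXn2r; rewrite ?nnegrE ?gsum // mulr_ge0 ?ler0n.
  have bn : (b <= n)%N by rewrite /n; lia.
  have -> : (2 * kap%:R) ^+ n / n`!%:R =
      (4 * kap%:R) ^+ n / n`!%:R * 2^-1 ^+ n :> R.
    rewrite mulrAC -exprMn; congr (_ ^+ _ / _); lra.
  have h2 : 2^-1 ^+ n <= 2^-1 ^+ j.+1 :> R.
    by apply: ler_wiXn2l; rewrite ?invr_ge0 // ?invf_le1 ?ler1n // /n; lia.
  have x0 : 0 <= (4 * kap%:R) ^+ n / n`!%:R :> R.
    by rewrite divr_ge0 ?ler0n // exprn_ge0 // mulr_ge0 ?ler0n.
  have y0 : 0 <= 2^-1 ^+ n :> R by rewrite exprn_ge0 // invr_ge0.
  apply: le_trans (ler_pM x0 y0 (hb n bn) h2) _.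
  by rewrite [in leRHS]exprS mulrA.
have km' : (kap < 2 ^ m)%N by lia.
have [_ /(_ [::] isT)] := @averages_sieve R hit' kap T (2 ^ m) b J m hs' m0
  (leqnn _) km'.
set N := (2 ^ _)%:R; rewrite /avg_error expr0 mulr1 big_nil mulr1 -/g.
under eq_bigr do rewrite big_nil mulr1.
move=> /(_ (fun p => ltac:(by rewrite in_nil))).
set L := lower_sieve g b J m in hLU *.
rewrite ler_distl => /andP[hlo _].
have gap : N < T%:R * L.
  have L12 : w ^+ J / 2 <= L.
    apply: le_trans hLU; have : 0 <= 2^-1 ^+ J.+1 :> R.
      by rewrite exprn_ge0 // invr_ge0.
    have : 0 < w ^+ J by rewrite exprn_gt0.
    by nra.
  pose M := (2 ^ (m * (2 ^ J * (8 * b + 12))))%N.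
  have NM : N <= M%:R.
    by rewrite ler_nat leq_exp2l // leq_mul2l error_exponent_le orbT.
  have TE : T = (M * 2 ^ (c * m * 2 ^ J) * 2 ^ (2 * m * 2 ^ J))%N.
    by rewrite /T /M -!expnD; congr (_ ^ _)%N; nia.
  have c1 : 1 <= w ^+ J * (2 ^ (c * m * 2 ^ J))%:R.
    apply: (@le_trans _ _ ((w * (2 ^ c)%:R) ^+ J)); first by rewrite exprn_ege1.
    rewrite exprMn -natrX -expnM ler_wpM2l ?exprn_ge0 ?(ltW w0) // ler_nat.
    rewrite leq_exp2l // -mulnA leq_mul2l; apply/orP; right.
    by rewrite (leq_trans (ltnW (ltn_expl J (isT : 1 < 2)%N))) // leq_pmull.
  have c4 : 4 <= (2 ^ (2 * m * 2 ^ J))%:R :> R.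
    rewrite (ler_nat R 4) (@leq_exp2l 2 2) // -mulnA leq_pmulr // muln_gt0 m0.
    by rewrite expn_gt0.
  have M0 : 0 < M%:R :> R by rewrite ltr0n expn_gt0.
  apply: le_lt_trans NM _.
  apply: (@lt_le_trans _ _ (T%:R * (w ^+ J / 2))); last by rewrite ler_wpM2l ?ler0n.
  rewrite TE !natrM -!mulrA ltr_pMr //.
  move: c1 c4; set u := (2 ^ (c * m * 2 ^ J))%:R.
  set v := (2 ^ (2 * m * 2 ^ J))%:R => c1 c4.
  rewrite [X in _ < X](_ : _ = (w ^+ J * u) * v / 2); last by ring.
  by nra.
have : 0 < \sum_(t < T) lower_sieve (hit_at R hit' t) b J m.
  by apply: lt_le_trans hlo; rewrite subr_gt0.
move=> S0.
have [t ht] : exists t : 'I_T, 0 < lower_sieve (hit_at R hit' t) b J m.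
  apply: contrapT => nt; move: S0; rewrite ltNge => /negP; apply.
  by apply: sumr_le0 => t _; rewrite leNgt; apply/negP => h; apply: nt; exists t.
exists t => // p pp /[dup] hp /andP[lp _].
have x01 q : 0 <= hit_at R hit' t q <= 1.
  by rewrite /hit_at; case: (hit' q t); rewrite ?lexx ?ler01.
have [_ _ Lu] := sieve_bounds b J m x01.
have un0 : unsieved (hit_at R hit' t) J m != 0.
  by apply: lt0r_neq0; apply: lt_le_trans Lu.
have := unsieved_gt0 m0 x01 un0 pp hp.
by rewrite /hit_at /hit' pp lp /=; case: (hit p t); rewrite ?eqxx.
Qed.

(** * Almost prime values of polynomials *)

Lemma horner_congr (H : {poly int}) (m a b : int) :
  (m %| a - b)%Z -> (m %| H.[a] - H.[b])%Z.
Proof.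
move=> mab; have : root (H - H.[b]%:P) b by rewrite rootE !hornerE subrr.
case/factor_theorem => q /(congr1 (fun P => P.[a])).
by rewrite !hornerE => ->; rewrite dvdz_mull.
Qed.

Lemma dvdz_horner (H : {poly int}) (m a b : int) :
  (m %| a - b)%Z -> (m %| H.[a])%Z = (m %| H.[b])%Z.
Proof.
by move=> /(horner_congr H) h; rewrite -[in LHS](subrK H.[b] H.[a]) rpredDl.
Qed.

(** For [N] prime to [p], the map [t |-> r + N t] permutes the classes modulo
    [p], and [H] remains nonzero over the field with [p] elements. *)
Lemma count_roots_mod (H : {poly int}) p r N :
  prime p -> ~~ (p %| `|lead_coef H|)%N -> ~~ (p %| N)%N ->
  (\sum_(t < p) (p%:Z %| H.[(r + N * t)%N%:Z])%Z <= (size H).-1)%N.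
Proof.
move=> pp plc pN; pose f := (intr : int -> 'F_p).
have pF := pchar_Fp pp.
have H0 : map_poly f H != 0.
  apply/negP => /eqP/(congr1 (fun P : {poly 'F_p} => P`_(size H).-1)).
  rewrite coef_map coef0 -lead_coefE => /eqP.
  by rewrite -(dvdz_pcharf pF) dvdzE (negPf plc).
pose rs : seq 'F_p :=
  [seq (r + N * t)%N%:R | t <- iota 0 p & (p%:Z %| H.[(r + N * t)%N%:Z])%Z].
have rroots : all (root (map_poly f H)) rs.
  apply/allP => _ /mapP[t + ->]; rewrite mem_filter => /andP[h _].
  rewrite rootE; have -> : (r + N * t)%N%:R = f (r + N * t)%N%:Z by rewrite /f -pmulrn.
  by rewrite horner_map /f -(dvdz_pcharf pF).
have inj s t : (s <= t < p)%N ->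
    (r + N * s)%N%:R = (r + N * t)%N%:R :> 'F_p -> s = t.
  move=> /andP[st tp] /eqP; rewrite eq_sym -subr_eq0 -natrB; last first.
    by rewrite leq_add2l leq_mul2l st orbT.
  rewrite subnDl -mulnBr -(dvdn_pcharf pF) Euclid_dvdM // (negPf pN) /=.
  case E : (t - s)%N => [|k].
    by move=> _; apply/eqP; rewrite eqn_leq st -subn_eq0 E.
  by move/(dvdn_leq (ltn0Sn _)); rewrite -E leqNgt (leq_ltn_trans (leq_subr _ _) tp).
have urs : uniq rs.
  rewrite map_inj_in_uniq ?filter_uniq ?iota_uniq //.
  move=> s t; rewrite !mem_filter !mem_iota /= !add0n => /andP[_ sp] /andP[_ tp] e.
  have [st|/ltnW ts] := leqP s t; first by apply: inj e; rewrite st.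
  by apply/esym; apply: inj (esym e); rewrite ts.
have := max_poly_roots H0 rroots urs.
rewrite size_map size_filter => h.
have -> : \sum_(t < p) ((p%:Z %| H.[(r + N * t)%N%:Z])%Z : nat) =
    count (fun t => (p%:Z %| H.[(r + N * t)%N%:Z])%Z) (iota 0 p).
  rewrite -(big_mkord xpredT (fun t => (p%:Z %| H.[(r + N * t)%N%:Z])%Z : nat)).
  rewrite /index_iota subn0 -sum1_count [RHS]big_mkcond.
  by apply: eq_bigr => t _; case: ifP.
rewrite -ltnS; apply: leq_trans h _; apply: leq_trans (size_poly _ _) _.
exact: leqSpred.
Qed.

(** A nonzero constant term is divisible by every positive integer root. *)
Lemma horner_eventually_neq0 (H : {poly int}) :
  H != 0 -> exists n0, forall n, (n0 <= n)%N -> H.[n%:Z] != 0.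
Proof.
elim/poly_ind: H => [|Q c IH]; first by rewrite eqxx.
have [-> Qn0|c0 _] := eqVneq c 0.
  have [Q0|Q0] := eqVneq Q 0; first by rewrite Q0 mul0r addr0 eqxx in Qn0.
  have [n0 hn0] := IH Q0; exists (maxn n0 1) => n; rewrite geq_max => /andP[h1 h2].
  by rewrite !hornerE mulf_neq0 ?hn0 //; case: n h2 {h1}.
exists `|c|.+1 => n cn; apply/negP => /eqP; rewrite !hornerE => /eqP.
rewrite addrC addr_eq0 => /eqP E.
have : (n%:Z %| c)%Z by rewrite E rpredN dvdz_mull.
rewrite dvdzE /= => /dvdn_leq; rewrite absz_gt0 c0 => /(_ isT).
by rewrite leqNgt cn.
Qed.

Lemma horner_growth (H : {poly int}) :
  exists h, forall n, (0 < n)%N -> (`|H.[n%:Z]| <= h * n ^ (size H).-1)%N.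
Proof.
exists (\sum_(i < size H) `|(H`_i)%R|)%N => n n0; rewrite horner_coef big_distrl /=.
apply: (@leq_trans (\sum_(i < size H) `|(H`_i * n%:Z ^+ i)%R|)%N).
  elim/big_ind2: _ => // x1 y1 x2 y2 h1 h2.
  apply: leq_trans (leq_add h1 h2).
  by rewrite -lez_nat PoszD !abszE ler_normD.
apply: leq_sum => i _; rewrite abszM abszX /= leq_mul2l leq_pexp2l ?orbT //.
by rewrite -ltnS prednK ?ltn_ord // (leq_ltn_trans _ (ltn_ord i)).
Qed.

(** Splitting off a prime factor at most doubles the number of divisors and
    reduces [v] by a factor above [z]. *)
Lemma size_divisors_rough z D v :
  (0 < z)%N -> (0 < v < z ^ D)%N -> (forall p, prime p -> (p %| v)%N -> (z < p)%N) ->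
  (size (divisors v) <= 2 ^ D)%N.
Proof.
move=> z0; elim: D v => [|D IH] v /andP[v0 vz] hv.
  by move: vz; rewrite expn0 ltnS leqNgt v0.
have [v1|v1] := leqP v 1.
  have -> : v = 1%N by apply/eqP; rewrite eqn_leq v1.
  by rewrite expn_gt0.
have pp := pdiv_prime v1; have pv := pdiv_dvd v.
set p := pdiv v in pp pv.
have [w vE] := dvdnP pv.
have w0 : (0 < w)%N by move: v0; rewrite vE muln_gt0 => /andP[].
have wz : (w < z ^ D)%N.
  rewrite -(ltn_pmul2r z0) -expnSr; apply: leq_ltn_trans vz.
  by rewrite vE leq_mul2l ltnW ?orbT // hv.
have dvw : (w %| v)%N by rewrite vE dvdn_mulr.
have h : (size (divisors w) <= 2 ^ D)%N.
  apply: IH => [|q pq qw]; first by rewrite w0.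
  by apply: hv => //; apply: dvdn_trans dvw.
rewrite expnS mul2n -addnn.
apply: (@leq_trans (size (divisors w ++ map (muln p) (divisors w)))).
  apply: uniq_leq_size; first exact: divisors_uniq.
  move=> d; rewrite -dvdn_divisors // mem_cat -dvdn_divisors // vE => dv.
  have [pd|pd] := boolP (p %| d)%N.
    have [e dE] := dvdnP pd; apply/orP; right; apply/mapP; exists e.
      by rewrite -dvdn_divisors // -(@dvdn_pmul2r p) -?dE // prime_gt0.
    by rewrite dE mulnC.
  by rewrite -(@Gauss_dvdl d w p) ?dv // coprime_sym prime_coprime.
by rewrite size_cat size_map leq_add.
Qed.

(** The sieve is applied to [H (r + N t)], ignoring the primes of [N].  All
    primes up to the largest sieved prime [z] are then excluded from the part of
    [H n] prime to [N], while [H n] is at most a fixed power of [z]. *)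
Lemma almost_prime_values (R : realType) (H : {poly int}) : H != 0 ->
  exists y0 B, forall N r y1, (0 < N)%N ->
    (forall p, prime p -> (p <= y0)%N -> (p %| N)%N) ->
    exists n, [/\ (y1 <= n)%N, n = r %[mod N], H.[n%:Z] != 0,
      forall p, prime p -> (p %| `|H.[n%:Z]|)%N -> ~~ (p %| N)%N -> (y1 < p)%N
    & (size (divisors `|H.[n%:Z]| `_(\pi(N)^')) <= B)%N].
Proof.
move=> H0; pose d := (size H).-1.
have [C hC] := sieve R d.
have [n0 hn0] := horner_eventually_neq0 H0.
have [h hh] := horner_growth H.
pose m := (2 * d + `|lead_coef H|).+1%N.
have mlt : (m < 2 ^ m)%N by apply: ltn_expl.
(* the exponent bounds [H n] by a power of [z]: below, [n <= z ^ C.+1] and the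
   absolute value of [H n] is less than [z * n ^ d] *)
exists (2 ^ m)%N, (2 ^ (d * C.+1 + 2))%N => N r y1 N0 hN.
(* the shift takes [n] beyond [y1] and the roots of [H] *)
pose r' := (r + N * (y1 + n0).+1)%N.
pose J := (y1 + h + r' + N)%N.
pose z := (2 ^ (m * 2 ^ J))%N.
have Jz : (J < z)%N.
  apply: leq_trans (ltn_expl J (isT : 1 < 2)%N) _.
  by rewrite leq_exp2l // (leq_trans (ltnW (ltn_expl J (isT : 1 < 2)%N))) // leq_pmull.
pose hit p t := ~~ (p %| N)%N && (p%:Z %| H.[(r' + N * t)%N%:Z])%Z.
have [|||t tz ht] := hC m J hit; first by [].
- by apply: leq_ltn_trans mlt; rewrite /m; lia.
- move=> p pp lp; split=> [t|].
    congr (_ && _); apply: dvdz_horner.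
    by rewrite mulnDr addnA PoszD addrAC subrr add0r dvdzE /= dvdn_mull.
  have [pN|pN] := boolP (p %| N)%N.
    by rewrite big1 // => t _; rewrite /hit pN.
  under eq_bigr do rewrite /hit pN /=.
  apply: count_roots_mod => //; apply/negP => /dvdn_leq.
  rewrite absz_gt0 lead_coef_eq0 H0 => /(_ isT) pl.
  have := leq_trans lp pl; rewrite ltnNge => /negP; apply.
  by apply: ltnW; apply: leq_ltn_trans mlt; rewrite leqW // leq_addl.
pose n := (r' + N * t)%N; exists n.
have nn : H.[n%:Z] != 0 by apply: hn0; rewrite /n /r'; nia.
have rough p : prime p -> (p %| `|H.[n%:Z]|)%N -> ~~ (p %| N)%N -> (z < p)%N.
  move=> pp ph pN; rewrite ltnNge; apply/negP => pz.
  have lp : (2 ^ m < p)%N.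
    by rewrite ltnNge; apply: contra pN => /(hN p pp).
  have : ~~ hit p t by apply: ht; rewrite // lp.
  by rewrite /hit pN dvdzE ph.
split => //.
- by rewrite /n /r'; nia.
- by rewrite /n /r' -addnA -mulnDr mulnC addnC modnMDl.
- move=> p pp ph pN; apply: leq_ltn_trans (rough p pp ph pN).
  by rewrite (leq_trans _ (ltnW Jz)) // /J; lia.
have Hn0 : (0 < `|H.[n%:Z]|)%N by rewrite absz_gt0.
have z0 : (0 < z)%N by rewrite expn_gt0.
apply: (@size_divisors_rough z) => //; last first.
  move=> p pp pv; apply: rough => //; first by apply: dvdn_trans pv (dvdn_part _ _).
  have pin : p \in \pi((`|H.[n%:Z]| `_(\pi(N)^'))%N) by rewrite mem_primes pp part_gt0.
  have := pnatPpi (part_pnat _ _) pin.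
  by rewrite inE /= mem_primes pp N0.
rewrite part_gt0 /=; apply: leq_ltn_trans (dvdn_leq Hn0 (dvdn_part _ _)) _.
have ngt0 : (0 < n)%N by rewrite /n /r'; nia.
apply: leq_ltn_trans (hh n ngt0) _; rewrite -/d.
have nz : (n <= z ^ C.+1)%N.
  have tz' : (t < z ^ C)%N by rewrite -expnM mulnC mulnA.
  rewrite expnS; apply: (@leq_trans ((r' + N) * z ^ C)); last first.
    by rewrite leq_mul2r; apply/orP; right; apply: leq_trans (ltnW Jz); rewrite /J; lia.
  rewrite /n mulnDl leq_add //; first by rewrite leq_pmulr // (leq_ltn_trans _ tz').
  by rewrite leq_mul2l ltnW ?orbT.
have hz : (h < z)%N by apply: leq_ltn_trans Jz; rewrite /J; lia.
have z1 : (1 < z)%N by apply: leq_ltn_trans Jz; rewrite /J /r'; nia.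
rewrite expnD.
have nd : (n ^ d <= z ^ (d * C.+1))%N.
  by rewrite mulnC expnM; elim: (d) => // e IH; rewrite !(expnS _ e) leq_mul.
have zd : (0 < z ^ (d * C.+1))%N by rewrite expn_gt0 z0.
apply: (@leq_ltn_trans (h * z ^ (d * C.+1))); first by rewrite leq_mul2l nd orbT.
by rewrite mulnC ltn_pmul2l //; apply: leq_trans hz _; rewrite leq_pmulr.
Qed.

(** * From limits superior to divisor counts of naturals *)

Definition count_divisors (A : set nat) (m : nat) : nat :=
  size [seq a <- divisors m | `[< A a >]].

Lemma divisor_countE (R : realType) (A : set nat) (u : int) : u != 0 ->
  divisor_count R A u = (count_divisors A `|u|)%:R%:E.
Proof.
move=> u0; have au : (0 < `|u|)%N by rewrite absz_gt0.
rewrite /divisor_count /count_divisors; set s := [seq _ <- _ | _].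
have us : uniq s by rewrite filter_uniq // divisors_uniq.
have -> : [set a | A a /\ (a%:Z %| u)%Z]%classic = [set` [fset a in s]%fset]%classic.
  apply/seteqP; split => a /=; rewrite inE mem_filter -dvdn_divisors // dvdzE /=.
    by case=> Aa ->; rewrite andbT; apply/asboolP.
  by case/andP => /asboolP.
rewrite /counting asboolT; last exact: finite_fset.
by rewrite set_fsetK card_fseq undup_id.
Qed.

Definition far_apart M x y := (M + x <= y)%N || (M + y <= x)%N.

Lemma divisor_gapE (R : realType) (A : set nat) (u v : int) M :
  u != 0 -> v != 0 ->
  (M%:R%:E <= divisor_gap R A u v)%E =
  far_apart M (count_divisors A `|u|) (count_divisors A `|v|).
Proof.
move=> u0 v0; rewrite /divisor_gap (negPf u0) (negPf v0) /=.
rewrite !divisor_countE // -EFinB /abse /= lee_fin /far_apart orbC.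
by rewrite ler_normr opprB !lerBrDr -!natrD !ler_nat.
Qed.

(** The property of the theorem in terms of natural numbers: for a nonzero [u]
    only finitely many elements divide [u], and a nonzero polynomial has finitely
    many roots, so neither infinite counts nor infinite gaps matter in the limit
    superior. *)
Definition gaps_unbounded (F G : {poly int}) :=
  forall A : set nat, (forall a, A a -> (0 < a)%N) -> infinite_set A ->
  forall M N, exists n, [/\ (N <= n)%N, F.[n%:Z] != 0, G.[n%:Z] != 0 &
    far_apart M (count_divisors A `|F.[n%:Z]|) (count_divisors A `|G.[n%:Z]|)].

Lemma unbounded_gapsP (R : realType) (F G : {poly int}) : F != 0 -> G != 0 ->
  unbounded_gaps R F G <-> gaps_unbounded F G.
Proof.
move=> F0 G0; have [nF hF] := horner_eventually_neq0 F0.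
have [nG hG] := horner_eventually_neq0 G0.
split=> H A Apos Ainf.
  move=> M N; apply: contrapT => nex; have := H A Apos Ainf.
  pose V := [set k | (N + nF + nG <= k)%N]%classic.
  suff : (limn_esup (fun n => divisor_gap R A F.[n.+1%:Z] G.[n.+1%:Z]) <= M%:R%:E)%E.
    by move=> /[swap] ->; rewrite leye_eq.
  apply: (@le_trans _ _ (ereal_sup ((fun n => divisor_gap R A F.[n.+1%:Z]
      G.[n.+1%:Z]) @` V)%classic)).
    by apply: ereal_inf_lbound; exists V => //; exists (N + nF + nG)%N.
  apply/ereal_supP => _ [k /= Vk <-].
  have nF0 : F.[k.+1%:Z] != 0 by apply: hF; move: Vk; rewrite /V /=; lia.
  have nG0 : G.[k.+1%:Z] != 0 by apply: hG; move: Vk; rewrite /V /=; lia.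
  rewrite leNgt; apply/negP => /ltW; rewrite divisor_gapE // => far.
  by apply: nex; exists k.+1; split => //; move: Vk; rewrite /V /=; lia.
apply/ereal_inf_pinfty => _ /= [V [N _ VN] <-].
apply: eq_infty => r.
have [M hM] : exists M : nat, r <= M%:R.
  exists (Num.bound `|r|); apply: le_trans (ler_norm r) _.
  by rewrite ltW // archi_boundP.
have [n] := H A Apos Ainf M N.+1; case: n => [|n] [Nn nF0 nG0 far] //.
apply: (@le_trans _ _ M%:R%:E); first by rewrite lee_fin.
apply: (@le_trans _ _ (divisor_gap R A F.[n.+1%:Z] G.[n.+1%:Z])).
  by rewrite divisor_gapE.
by apply: ereal_sup_ubound; exists n => //; apply: VN.
Qed.

Lemma gaps_unboundedC (F G : {poly int}) :
  gaps_unbounded F G -> gaps_unbounded G F.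
Proof.
move=> H A Ap Ai M N; have [n [h1 h2 h3 h4]] := H A Ap Ai M N.
by exists n; split; rewrite // /far_apart orbC.
Qed.

Lemma count_divisors_le A m : (count_divisors A m <= size (divisors m))%N.
Proof. by rewrite /count_divisors size_filter count_size. Qed.

Lemma leq_count_divisors (A : set nat) m (s : seq nat) :
  (0 < m)%N -> uniq s -> {in s, forall a, A a /\ (a %| m)%N} ->
  (size s <= count_divisors A m)%N.
Proof.
move=> m0 us hs; apply: uniq_leq_size => // a /hs [Aa am].
by rewrite mem_filter -dvdn_divisors // am andbT; apply/asboolP.
Qed.

Lemma count_divisors_sub (A : set nat) m (s : seq nat) :
  (0 < m)%N -> (forall a, A a -> (a %| m)%N -> a \in s) ->
  (count_divisors A m <= size s)%N.
Proof.
move=> m0 hs; apply: uniq_leq_size; first by rewrite filter_uniq // divisors_uniq.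
move=> a; rewrite mem_filter -dvdn_divisors // => /andP[/asboolP Aa am]; exact: hs.
Qed.

(** A divisor [d] of [K * v] is the product of [gcdn d K] and a divisor of
    [v]. *)
Lemma size_divisorsM K v : (0 < K)%N -> (0 < v)%N ->
  (size (divisors (K * v)) <= size (divisors K) * size (divisors v))%N.
Proof.
move=> K0 v0.
rewrite -(size_allpairs muln); apply: uniq_leq_size; first exact: divisors_uniq.
move=> d; rewrite -dvdn_divisors ?muln_gt0 ?K0 // => dKv.
have d0 : (0 < d)%N by apply: dvdn_gt0 dKv; rewrite muln_gt0 K0.
have g0 : (0 < gcdn d K)%N by rewrite gcdn_gt0 d0.
apply/allpairsP; exists (gcdn d K, d %/ gcdn d K)%N; split=> /=.
- by rewrite -dvdn_divisors // dvdn_gcdr.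
- rewrite -dvdn_divisors // -(@Gauss_dvdr _ (K %/ gcdn d K)).
    by rewrite -(dvdn_pmul2r g0) divnK ?dvdn_gcdl // mulnAC divnK ?dvdn_gcdr.
  rewrite /coprime -(eqn_pmul2r g0) mul1n muln_gcdl !divnK ?dvdn_gcdl ?dvdn_gcdr //.
by rewrite mulnC divnK // dvdn_gcdl.
Qed.

(** * Divisibility of values *)

Lemma leq_size_divisors u K : (0 < K)%N -> (u %| K)%N ->
  (size (divisors u) <= size (divisors K))%N.
Proof.
move=> K0 uK; have u0 := dvdn_gt0 K0 uK.
apply: uniq_leq_size; first exact: divisors_uniq.
by move=> d; rewrite -!dvdn_divisors // => /dvdn_trans; apply.
Qed.

Lemma dvdn_logn d m : (0 < d)%N -> (0 < m)%N ->
  (forall p, prime p -> (p %| d)%N -> (logn p d <= logn p m)%N) -> (d %| m)%N.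
Proof.
move=> d0 m0 h; apply/dvdn_partP => // p; rewrite mem_primes => /and3P[pp _ pd].
by rewrite p_part pfactor_dvdn // h.
Qed.

Lemma part_dvdn_logn N m K : (0 < N)%N -> (0 < m)%N -> (0 < K)%N ->
  (forall p, prime p -> (p %| N)%N -> (logn p m <= logn p K)%N) ->
  (m`_(\pi(N)) %| K)%N.
Proof.
move=> N0 m0 K0 h; apply: dvdn_logn => // p pp pd.
have pin : p \in \pi((m`_(\pi(N)))%N) by rewrite mem_primes pp part_gt0.
have pN := pnatPpi (part_pnat _ _) pin.
move: (pN); rewrite mem_primes => /and3P[_ _ pdN].
by apply: leq_trans (h p pp pdN); rewrite dvdn_leq_log // dvdn_part.
Qed.

Lemma size_divisors_split N m K B : (0 < m)%N -> (0 < K)%N ->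
  (m`_(\pi(N)) %| K)%N -> (size (divisors m`_(\pi(N)^')) <= B)%N ->
  (size (divisors m) <= size (divisors K) * B)%N.
Proof.
move=> m0 K0 uK vB; rewrite -[X in divisors X](partnC \pi(N)) //.
apply: leq_trans (size_divisorsM _ _) _; rewrite ?part_gt0 //.
by rewrite leq_mul // leq_size_divisors.
Qed.

(** Coprimality over the rationals, as seen on values: a Bezout relation
    [s P + t Q = R] with [R] a nonzero integer gives this property. *)
Definition almost_coprime (P Q : {poly int}) :=
  exists2 R, (0 < R)%N & forall (n : int) (d : nat),
    (d %| `|P.[n]|)%N -> (d %| `|Q.[n]|)%N -> (d %| R)%N.

Lemma almost_coprimeC P Q : almost_coprime P Q -> almost_coprime Q P.
Proof. by case=> R R0 h; exists R => // n d h1 h2; apply: h h2 h1. Qed.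

Lemma almost_coprime1 P : almost_coprime P 1.
Proof. by exists 1%N => // n d _; rewrite hornerE. Qed.

Lemma almost_coprime_const P c : c != 0 -> almost_coprime P c%:P.
Proof.
by move=> c0; exists `|c|%N; rewrite ?absz_gt0 // => n d _; rewrite hornerE.
Qed.

Lemma almost_coprimeM P Q1 Q2 :
  almost_coprime P Q1 -> almost_coprime P Q2 -> almost_coprime P (Q1 * Q2).
Proof.
move=> [R1 R10 h1] [R2 R20 h2]; exists (R1 * R2)%N; rewrite ?muln_gt0 ?R10 //.
move=> n d dP; rewrite hornerM abszM => dQ.
set a := `|Q1.[n]|%N in dQ; set g := gcdn d a.
have [d0|d0] := posnP d.
  move: (dQ); rewrite d0 dvd0n muln_eq0 -d0 => /orP[] /eqP e.
    by apply/dvdn_mulr/(h1 n) => //; rewrite -/a e.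
  by apply/dvdn_mull/(h2 n) => //; rewrite e.
have g0 : (0 < g)%N by rewrite gcdn_gt0 d0.
have gR : (g %| R1)%N.
  by apply: (h1 n) (dvdn_gcdr _ _); apply: dvdn_trans (dvdn_gcdl _ _) dP.
rewrite -[d](divnK (dvdn_gcdl d a)) mulnC dvdn_mul // -/g.
apply: (h2 n); first by apply: dvdn_trans dP; rewrite dvdn_div // dvdn_gcdl.
rewrite -(@Gauss_dvdr _ (a %/ g)).
  by rewrite -(dvdn_pmul2r g0) divnK ?dvdn_gcdl // mulnAC divnK ?dvdn_gcdr.
by rewrite /coprime -(eqn_pmul2r g0) mul1n muln_gcdl !divnK ?dvdn_gcdl ?dvdn_gcdr.
Qed.

(** If [p] divides [m1] to a higher power than the bound [R] on common divisors
    allows, its multiplicity in [m2] is limited by [R]. *)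
Lemma logn_almost_coprime (R m1 m2 : nat) p : prime p -> (0 < R)%N -> (0 < m2)%N ->
  (forall d, (d %| m1)%N -> (d %| m2)%N -> (d %| R)%N) ->
  (p ^ (logn p R).+1 %| m1)%N -> (logn p m2 <= logn p R)%N.
Proof.
move=> pp R0 m20 h h1; rewrite leqNgt; apply/negP => lt.
have := h _ h1; rewrite !pfactor_dvdn // ltnn => /(_ lt) //.
Qed.

Lemma intersective_nat (H : {poly int}) m : (0 < m)%N -> intersective H ->
  exists r : nat, (m%:Z %| H.[r%:Z])%Z.
Proof.
move=> m0 /(_ m m0) [n hn]; have hm : (n %% m%:Z)%Z >= 0 by rewrite modz_ge0 // -lt0n.
exists `|(n %% m%:Z)%Z|%N; rewrite gez0_abs // (@dvdz_horner H m _ n).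
  by rewrite -[X in (_ %| X)%Z]subr0 -eqz_mod_dvd hn.
by rewrite -eqz_mod_dvd modz_mod.
Qed.

Lemma dvdz_horner_mod (H : {poly int}) (m a b : nat) :
  a = b %[mod m] -> (m%:Z %| H.[a%:Z])%Z = (m%:Z %| H.[b%:Z])%Z.
Proof. by move=> e; apply: dvdz_horner; rewrite -eqz_mod_dvd !modz_nat e. Qed.

Lemma eqn_modW (N m a b : nat) : (m %| N)%N -> a = b %[mod N] -> a = b %[mod m].
Proof. by move=> mN e; rewrite -(modn_dvdm a mN) e modn_dvdm. Qed.

Lemma dvdn_prod_seq (s : seq nat) (f : nat -> nat) a :
  a \in s -> (f a %| \prod_(x <- s) f x)%N.
Proof. by move=> h; rewrite (big_rem a) //= dvdn_mulr. Qed.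

Lemma prod_seq_gt0 (s : seq nat) (f : nat -> nat) :
  {in s, forall a, (0 < f a)%N} -> (0 < \prod_(x <- s) f x)%N.
Proof. by move=> h; rewrite big_seq; apply: prodn_cond_gt0. Qed.

Lemma infinite_sample (A : set nat) k : infinite_set A ->
  exists s : seq nat, [/\ uniq s, (k <= size s)%N & forall a, a \in s -> A a].
Proof.
move=> /(infinite_set_fset k)[S SA Sk]; exists (enum_fset S); split.
- exact: fset_uniq.
- exact: Sk.
by move=> a aS; apply: SA.
Qed.

(** All primes of the modulus occur in it, and hence in [U n], to a higher power
    than in the constant [R1] of almost coprimality, because [R1] enters the
    modulus twice; so the part of [G n] composed of these primes divides [R1],
    and [G n] has a bounded number of divisors. *)
Lemma gaps_of_intersective_part (R : realType) (F G U : {poly int}) :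
  F != 0 -> G != 0 -> intersective U ->
  (forall n : int, (`|U.[n]| %| `|F.[n]|)%N) -> almost_coprime U G ->
  gaps_unbounded F G.
Proof.
move=> F0 G0 Uint UF [R1 R10 hR] A Apos Ainf M N0.
have [y0 [B hB]] := almost_prime_values R G0.
have [nF hF] := horner_eventually_neq0 F0.
have [s [us sk sA]] := infinite_sample (M + size (divisors R1) * B) Ainf.
pose L := (\prod_(a <- s) a)%N; pose N := (L * y0`! * R1 * R1)%N.
have L0 : (0 < L)%N by apply: prod_seq_gt0 => a /sA /Apos.
have N_gt0 : (0 < N)%N by rewrite !muln_gt0 L0 fact_gt0 R10.
have [r hr] := intersective_nat N_gt0 Uint.
have [|n [nge nr Gn rough Bn]] := hB N r (N0 + nF)%N N_gt0.
  move=> p pp py; do 2 apply: dvdn_mulr; apply: dvdn_mull.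
  by rewrite dvdn_fact // prime_gt0.
have NU : (N %| `|U.[n%:Z]|)%N by move: hr; rewrite -(dvdz_horner_mod U nr) dvdzE.
have Fn : F.[n%:Z] != 0 by apply: hF; apply: leq_trans nge; apply: leq_addl.
have Gn0 : (0 < `|G.[n%:Z]|)%N by rewrite absz_gt0.
exists n; split => //; first exact: leq_trans (leq_addr _ _) nge.
apply/orP; right.
have cF : (size s <= count_divisors A `|F.[n%:Z]|)%N.
  apply: leq_count_divisors => //; first by rewrite absz_gt0.
  move=> a sa; split; first exact: sA.
  apply: dvdn_trans (UF n); apply: dvdn_trans NU.
  by do 3 apply: dvdn_mulr; apply: (@dvdn_prod_seq s id).
have uR : (`|G.[n%:Z]| `_(\pi(N)) %| R1)%N.
  apply: part_dvdn_logn => // p pp pN.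
  apply: (@logn_almost_coprime _ `|U.[n%:Z]|%N) => //; first exact: hR.
  apply: dvdn_trans NU; rewrite pfactor_dvdn //.
  rewrite /N !lognM ?muln_gt0 ?L0 ?fact_gt0 ?R10 //.
  have [pR|pR] := posnP (logn p R1).
    have : (0 < logn p N)%N by rewrite logn_gt0 mem_primes pp N_gt0.
    by rewrite /N !lognM ?muln_gt0 ?L0 ?fact_gt0 ?R10 // pR; clear; lia.
  by move: pR; clear; lia.
have cG := size_divisors_split Gn0 R10 uR Bn.
by have := count_divisors_le A `|G.[n%:Z]|%N; move: sk cF cG; clear; lia.
Qed.

(** * A common linear factor *)

Lemma logn_partn (pi : nat_pred) p m : p \in pi -> (0 < m)%N ->
  logn p m`_pi = logn p m.
Proof.
move=> ppi m0; rewrite -[in RHS](partnC pi m0) lognM ?part_gt0 //.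
suff -> : logn p m`_pi^' = 0%N by rewrite addn0.
apply/eqP; rewrite -leqn0 leqNgt logn_gt0; apply/negP => h.
by have := pnatPpi (part_pnat _ _) h; rewrite inE /= ppi.
Qed.

Lemma logn_lt_sqr p X R : prime p -> (0 < X)%N -> (0 < R)%N -> (p %| X * R * R)%N ->
  (logn p R < logn p (X * R * R))%N.
Proof.
move=> pp X0 R0 pN; have N0 : (0 < X * R * R)%N by rewrite 2!(muln_gt0 _ R) X0 R0.
have [pR|pR] := posnP (logn p R).
  by rewrite pR logn_gt0 mem_primes pp N0.
by rewrite !lognM ?muln_gt0 ?X0 // -addnA addnC; lia.
Qed.

(** A congruence modulo a higher power of [p] than the one dividing [w] pins down
    the multiplicity of [p]. *)
Lemma logn_congr p (x : int) w : prime p -> (0 < w)%N ->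
  ((p ^ (logn p w).+1)%N%:Z %| x - w%:Z)%Z -> logn p `|x| = logn p w.
Proof.
move=> pp w0 h.
have hd k : (k <= (logn p w).+1)%N -> (p ^ k %| `|x|)%N = (p ^ k %| w)%N.
  move=> kw; have h' : ((p ^ k)%N%:Z %| x - w%:Z)%Z.
    by apply: dvdz_trans h; rewrite dvdzE /= dvdn_exp2l.
  have : ((p ^ k)%N%:Z %| x)%Z = ((p ^ k)%N%:Z %| w%:Z)%Z.
    by rewrite -[in LHS](subrK w%:Z x) rpredDl.
  by rewrite !dvdzE.
have x0 : (0 < `|x|)%N.
  rewrite lt0n; apply/negP => /eqP x0; have := hd _ (leqnn _).
  by rewrite x0 dvdn0 pfactor_dvdn // ltnn.
apply/eqP; rewrite eqn_leq; apply/andP; split; last first.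
  by rewrite -pfactor_dvdn // hd // pfactor_dvdn.
by rewrite leqNgt -pfactor_dvdn // hd // pfactor_dvdn // ltnn.
Qed.

(** What the proof uses about three linear factors, [al] being the absolute value
    of the leading coefficient of [U]: the primes of [al] are exactly those at
    which [U] gives no help. *)
Record factor_triple (F G C U V : {poly int}) (al : nat) : Prop := FactorTriple {
  ft_al : (0 < al)%N;
  ft_F : exists2 c, c != 0 & F = c%:P * (C * U);
  ft_G : exists2 c, c != 0 & G = c%:P * (C * V);
  ft_UG : almost_coprime U G;
  ft_CV : almost_coprime C V;
  ft_U : forall m, (0 < m)%N -> coprime m al ->
    exists n : nat, (m%:Z %| U.[n%:Z])%Z;
  ft_Uq : forall q (n : int), prime q -> (q %| al)%N -> ~~ (q %| `|U.[n]|)%N;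
  ft_C : forall m w : nat, \pi(al).-nat m ->
    exists n : nat, (m%:Z %| C.[n%:Z] - w%:Z)%Z;
  ft_V : forall m, \pi(al).-nat m -> exists n : nat, (m%:Z %| V.[n%:Z])%Z }.

Lemma mem_pi_al al p : (0 < al)%N -> prime p -> (p \in \pi(al)) = (p %| al)%N.
Proof. by move=> al0 pp; rewrite mem_primes pp al0. Qed.

Lemma mem_pi'_al al p : (0 < al)%N -> prime p -> (p \in \pi(al)^') = ~~ (p %| al)%N.
Proof. by move=> al0 pp; rewrite inE /= mem_primes pp al0. Qed.

(** Here [C n] takes care of a modulus [M] composed of primes of [al], and [U n]
    of a modulus [L'] prime to [al].  The price is that [M], through [C], also
    divides [G n]; but apart from this and a bounded factor [K], the value [G n]
    is almost prime. *)
Lemma triple_CU_values (R : realType) F G C U V al :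
  F != 0 -> G != 0 -> factor_triple F G C U V al ->
  exists K B, (0 < K)%N /\ forall M L' y1,
    \pi(al).-nat M -> \pi(al)^'.-nat L' ->
    exists n u v,
      [/\ (y1 <= n)%N, F.[n%:Z] != 0, G.[n%:Z] != 0, (M %| `|C.[n%:Z]|)%N
        & (L' %| `|U.[n%:Z]|)%N] /\
      [/\ `|G.[n%:Z]|%N = (u * v)%N, (u %| M * K)%N,
        forall p, prime p -> (p %| v)%N -> (y1 < p)%N
        & (size (divisors v) <= B)%N].
Proof.
move=> F0 G0 [al0 [c c0 FE] [c' c'0 GE] [R1 R10 hR1] [R2 R20 hR2] hU hUq hC _].
have [y0 [B hB]] := almost_prime_values R G0.
have [nF hF] := horner_eventually_neq0 F0.
pose rho := ((al * R2)`_(\pi(al)))%N.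
have rho0 : (0 < rho)%N by apply: part_gt0.
exists (`|c'| * rho * R2 * R1)%N, B; split.
  by rewrite !muln_gt0 absz_gt0 c'0 rho0 R20.
move=> M L' y1 MQ L'Q.
have M0 := part_gt0 \pi(al) M; rewrite part_pnat_id // in M0.
have L'0 := part_gt0 \pi(al)^' L'; rewrite part_pnat_id // in L'0.
(* [C n] is prescribed to have exactly the multiplicities of [w], which are
   large enough to bound those of [V n] *)
pose w := (M * rho)%N; have w0 : (0 < w)%N by rewrite muln_gt0 M0.
pose NQ := (w * al)%N.
have NQ0 : (0 < NQ)%N by rewrite muln_gt0 w0.
have NQQ : \pi(al).-nat NQ by rewrite !pnatM MQ part_pnat pnat_pi.
pose X := (L' * y0`!)%N; have X0 : (0 < X)%N by rewrite muln_gt0 L'0 fact_gt0.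
have XR0 : (0 < X * R1 * R1)%N by rewrite 2!(muln_gt0 _ R1) X0 R10.
pose N' := ((X * R1 * R1)`_(\pi(al)^'))%N.
have N'0 : (0 < N')%N by apply: part_gt0.
have N'Q : \pi(al)^'.-nat N' by apply: part_pnat.
have co : coprime NQ N' by apply: pnat_coprime NQQ N'Q.
pose N := (NQ * N')%N; have N0 : (0 < N)%N by rewrite muln_gt0 NQ0.
have [rC hrC] := hC NQ w NQQ.
have [rU hrU] : exists n : nat, (N'%:Z %| U.[n%:Z])%Z.
  by apply: hU => //; rewrite coprime_sym coprime_pi'.
pose r := chinese NQ N' rC rU.
have [|n [nge nr Gn rough Bn]] := hB N r (y1 + nF)%N N0.
  move=> p pp py; have [pal|pal] := boolP (p %| al)%N.
    by apply: dvdn_mulr; apply: dvdn_mull.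
  apply: dvdn_mull; rewrite -[p](@part_pnat_id \pi(al)^' p); last first.
    by rewrite pnatE // mem_pi'_al.
  apply: partn_dvd => //; do 2 apply: dvdn_mulr; apply: dvdn_mull.
  by rewrite dvdn_fact // prime_gt0.
have nC : n = rC %[mod NQ].
  by rewrite -(chinese_modl co rC rU); apply: eqn_modW nr; apply: dvdn_mulr.
have nU : n = rU %[mod N'].
  by rewrite -(chinese_modr co rC rU); apply: eqn_modW nr; apply: dvdn_mull.
have Cw : (NQ%:Z %| C.[n%:Z] - w%:Z)%Z.
  have -> : C.[n%:Z] - w%:Z = (C.[n%:Z] - C.[rC%:Z]) + (C.[rC%:Z] - w%:Z) by ring.
  by rewrite rpredD //; apply: horner_congr; rewrite -eqz_mod_dvd !modz_nat nC.
have UN' : (N' %| `|U.[n%:Z]|)%N by move: hrU; rewrite -(dvdz_horner_mod U nU) dvdzE.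
have Gn0 : (0 < `|G.[n%:Z]|)%N by rewrite absz_gt0.
have GnE : `|G.[n%:Z]|%N = (`|c'| * (`|C.[n%:Z]| * `|V.[n%:Z]|))%N.
  by rewrite GE !hornerE !abszM.
have [Cn0 Vn0] : (0 < `|C.[n%:Z]|)%N /\ (0 < `|V.[n%:Z]|)%N.
  by move: Gn0; rewrite GnE !muln_gt0 => /and3P[].
have c'gt0 : (0 < `|c'|)%N by rewrite absz_gt0.
exists n, (`|G.[n%:Z]| `_(\pi(N)))%N, (`|G.[n%:Z]| `_(\pi(N)^'))%N.
split; split => //.
- exact: leq_trans (leq_addr _ _) nge.
- by apply: hF; apply: leq_trans nge; apply: leq_addl.
- have : (M%:Z %| C.[n%:Z] - w%:Z)%Z.
    by apply: dvdz_trans Cw; rewrite dvdzE /= /NQ /w -mulnA dvdn_mulr.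
  have Mw : (M%:Z %| w%:Z)%Z by rewrite dvdzE /= dvdn_mulr.
  by move=> h; have := rpredD h Mw; rewrite subrK dvdzE.
- apply: dvdn_trans UN'; rewrite -[L'](part_pnat_id L'Q); apply: partn_dvd => //.
  by do 3 apply: dvdn_mulr.
- by rewrite partnC.
- have K0 : (0 < M * (`|c'| * rho * R2 * R1))%N.
    by rewrite !muln_gt0 M0 c'gt0 rho0 R20.
  apply: part_dvdn_logn => // p pp pN.
  have [pal|pal] := boolP (p %| al)%N; last first.
    have h : (logn p `|G.[n%:Z]| <= logn p R1)%N.
      apply: (@logn_almost_coprime _ `|U.[n%:Z]|%N) => //; first exact: hR1.
      apply: dvdn_trans UN'; rewrite pfactor_dvdn // logn_partn ?mem_pi'_al //.
      apply: logn_lt_sqr => //; apply: dvdn_trans (dvdn_part \pi(al)^' _).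
      move: pN; rewrite Euclid_dvdM // => /orP[|//] pNQ.
      have := pnatPpi NQQ; move=> /(_ p); rewrite mem_primes pp NQ0 pNQ mem_pi_al //.
      by rewrite (negPf pal) => /(_ isT).
    apply: leq_trans h _; rewrite lognM // ?muln_gt0 ?c'gt0 ?rho0 ?R20 //.
    by rewrite [in leqRHS](lognM _ _ R10) ?muln_gt0 ?c'gt0 ?rho0 // addnA leq_addl.
  have lal : (0 < logn p al)%N by rewrite logn_gt0 mem_primes pp al0.
  have lrho : logn p rho = (logn p al + logn p R2)%N.
    by rewrite logn_partn ?mem_pi_al ?muln_gt0 ?al0 // lognM.
  have lC : logn p `|C.[n%:Z]| = logn p w.
    apply: logn_congr => //; apply: dvdz_trans Cw; rewrite dvdzE /=.
    by rewrite pfactor_dvdn // (lognM _ w0 al0) -addn1 leq_add2l.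
  have lV : (logn p `|V.[n%:Z]| <= logn p R2)%N.
    apply: (@logn_almost_coprime _ `|C.[n%:Z]|%N) => //; first exact: hR2.
    by rewrite pfactor_dvdn // lC /w lognM // lrho; move: lal; clear; lia.
  rewrite GnE !lognM ?muln_gt0 ?M0 ?c'gt0 ?rho0 ?R20 ?Cn0 ?Vn0 //.
  by rewrite lC /w lognM //; move: lV; clear; lia.
- move=> p pp pv; have pG := dvdn_trans pv (dvdn_part _ _).
  have pin : p \in \pi((`|G.[n%:Z]| `_(\pi(N)^'))%N) by rewrite mem_primes pp part_gt0.
  have := pnatPpi (part_pnat _ _) pin; rewrite mem_pi'_al // => pN.
  by apply: leq_ltn_trans (rough p pp pG pN); apply: leq_addr.
Qed.

(** Here [V n] is highly divisible by primes of [al], and a fixed divisor [b] of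
    some value of [G] is kept.  The bound [K] on the divisors of [F n] depends on
    [b] but not on [E]: at the primes of [al] [U n] is a unit and [C n] is
    almost coprime to [V n], while at the other primes of the modulus [n] is so
    close to a fixed [n1] that [F n] and [F n1] have the same multiplicities. *)
Lemma triple_V_values (R : realType) F G C U V al b (n0 : int) :
  F != 0 -> G != 0 -> factor_triple F G C U V al ->
  \pi(al)^'.-nat b -> (b %| `|G.[n0]|)%N ->
  exists K, forall E y1, \pi(al).-nat E ->
    exists n,
      [/\ (y1 <= n)%N, F.[n%:Z] != 0, G.[n%:Z] != 0,
         (b * E %| `|G.[n%:Z]|)%N & (size (divisors `|F.[n%:Z]|) <= K)%N].
Proof.
move=> F0 G0 [al0 [c c0 FE] [c' c'0 GE] _ [R2 R20 hR2] _ hUq _ hV] bQ bG.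
have [y0 [B hB]] := almost_prime_values R F0.
have [nF hF] := horner_eventually_neq0 F0.
have [nG hG] := horner_eventually_neq0 G0.
have b0 := part_gt0 \pi(al)^' b; rewrite part_pnat_id // in b0.
(* a nonnegative representative of [n0] modulo [b] that is not a root of [F] *)
pose n1 := (`|(n0 %% b%:Z)%Z| + b * nF)%N.
have bG1 : (b %| `|G.[n1%:Z]|)%N.
  rewrite -[b]/`|b%:Z|%N -dvdzE (@dvdz_horner G b%:Z _ n0) ?dvdzE //.
  rewrite -dvdzE PoszD PoszM gez0_abs ?modz_ge0 -?lt0n //.
  by rewrite addrAC rpredD ?dvdz_mulr // -eqz_mod_dvd modz_mod.
pose f := `|F.[n1%:Z]|%N.
have f0 : (0 < f)%N.
  by rewrite absz_gt0; apply: hF; rewrite /n1 (leq_trans _ (leq_addl _ _)) // leq_pmull.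
have cgt0 : (0 < `|c|)%N by rewrite absz_gt0.
have K0 : (0 < f * `|c| * R2)%N by rewrite !muln_gt0 f0 cgt0.
exists (size (divisors (f * `|c| * R2)) * B)%N => E y1 EQ.
have E0 := part_gt0 \pi(al) E; rewrite part_pnat_id // in E0.
pose NQ := (E * (al * R2)`_(\pi(al)))%N.
have NQ0 : (0 < NQ)%N by rewrite muln_gt0 E0 part_gt0.
have NQQ : \pi(al).-nat NQ by rewrite pnatM EQ part_pnat.
pose X := (b * y0`!)%N; have X0 : (0 < X)%N by rewrite muln_gt0 b0 fact_gt0.
have Xf0 : (0 < X * f * f)%N by rewrite 2!(muln_gt0 _ f) X0 f0.
pose N' := ((X * f * f)`_(\pi(al)^'))%N.
have N'0 : (0 < N')%N by apply: part_gt0.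
have N'Q : \pi(al)^'.-nat N' by apply: part_pnat.
have co : coprime NQ N' by apply: pnat_coprime NQQ N'Q.
pose N := (NQ * N')%N; have N0 : (0 < N)%N by rewrite muln_gt0 NQ0.
have [rV hrV] := hV NQ NQQ.
pose r := chinese NQ N' rV n1.
have [|n [nge nr Fn rough Bn]] := hB N r (y1 + nG)%N N0.
  move=> p pp py; have [pal|pal] := boolP (p %| al)%N.
    apply: dvdn_mulr; apply: dvdn_mull.
    rewrite -[p](@part_pnat_id \pi(al) p); last first.
      by rewrite pnatE // mem_pi_al.
    by apply: partn_dvd; rewrite ?muln_gt0 ?al0 // dvdn_mulr.
  apply: dvdn_mull; rewrite -[p](@part_pnat_id \pi(al)^' p); last first.
    by rewrite pnatE // mem_pi'_al.
  apply: partn_dvd => //; do 2 apply: dvdn_mulr; apply: dvdn_mull.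
  by rewrite dvdn_fact // prime_gt0.
have nV : n = rV %[mod NQ].
  by rewrite -(chinese_modl co rV n1); apply: eqn_modW nr; apply: dvdn_mulr.
have nn1 : n = n1 %[mod N'].
  by rewrite -(chinese_modr co rV n1); apply: eqn_modW nr; apply: dvdn_mull.
have VNQ : (NQ %| `|V.[n%:Z]|)%N by move: hrV; rewrite -(dvdz_horner_mod V nV) dvdzE.
have bN' : (b %| N')%N.
  by rewrite -[b](part_pnat_id bQ); apply: partn_dvd => //; do 3 apply: dvdn_mulr.
have Fn0 : (0 < `|F.[n%:Z]|)%N by rewrite absz_gt0.
have FnE : `|F.[n%:Z]|%N = (`|c| * (`|C.[n%:Z]| * `|U.[n%:Z]|))%N.
  by rewrite FE !hornerE !abszM.
have [Cn0 Un0] : (0 < `|C.[n%:Z]|)%N /\ (0 < `|U.[n%:Z]|)%N.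
  by move: Fn0; rewrite FnE !muln_gt0 => /and3P[].
exists n; split => //.
- exact: leq_trans (leq_addr _ _) nge.
- by apply: hG; apply: leq_trans nge; apply: leq_addl.
- rewrite Gauss_dvd; last by rewrite coprime_sym; apply: pnat_coprime EQ bQ.
  apply/andP; split.
    have e := eqn_modW bN' nn1.
    by have := dvdz_horner_mod G e; rewrite !dvdzE => ->.
  have -> : `|G.[n%:Z]|%N = (`|c'| * `|C.[n%:Z]| * `|V.[n%:Z]|)%N.
    by rewrite GE !hornerE !abszM ?mulnA.
  by apply: dvdn_mull; apply: dvdn_trans VNQ; apply: dvdn_mulr.
apply: size_divisors_split Bn => //.
apply: part_dvdn_logn => // p pp pN.
have [pal|pal] := boolP (p %| al)%N; last first.
  have pN' : (p %| N')%N.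
    move: pN; rewrite Euclid_dvdM // => /orP[|//] pNQ.
    have := pnatPpi NQQ; move=> /(_ p); rewrite mem_primes pp NQ0 pNQ mem_pi_al //.
    by rewrite (negPf pal) => /(_ isT).
  have lf : (logn p f < logn p N')%N.
    rewrite logn_partn ?mem_pi'_al //; apply: logn_lt_sqr => //.
    exact: dvdn_trans (dvdn_part \pi(al)^' _).
  suff -> : logn p `|F.[n%:Z]| = logn p f.
    by rewrite !lognM ?muln_gt0 ?f0 ?cgt0 // -addnA leq_addr.
  have dv k : (k <= logn p N')%N -> (p ^ k %| `|F.[n%:Z]|)%N = (p ^ k %| f)%N.
    move=> kN; have pkN : (p ^ k %| N')%N by rewrite pfactor_dvdn.
    by have := dvdz_horner_mod F (eqn_modW pkN nn1); rewrite !dvdzE.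
  apply/eqP; rewrite eqn_leq; apply/andP; split; last first.
    by rewrite -pfactor_dvdn // dv ?(ltnW lf) // pfactor_dvdn.
  by rewrite leqNgt -pfactor_dvdn // dv // pfactor_dvdn // ltnn.
have lal : (0 < logn p al)%N by rewrite logn_gt0 mem_primes pp al0.
have lC : (logn p `|C.[n%:Z]| <= logn p R2)%N.
  apply: (@logn_almost_coprime _ `|V.[n%:Z]|%N) => //.
    by move=> d d1 d2; apply: hR2 d2 d1.
  apply: dvdn_trans VNQ; rewrite pfactor_dvdn // /NQ lognM ?part_gt0 //.
  rewrite logn_partn ?mem_pi_al ?muln_gt0 ?al0 // lognM //.
  by move: lal; clear; lia.
have lU : logn p `|U.[n%:Z]| = 0%N.
  by apply/eqP; rewrite -leqn0 leqNgt logn_gt0 mem_primes pp Un0 /= hUq.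
by rewrite FnE !lognM ?muln_gt0 ?f0 ?cgt0 ?Cn0 ?Un0 // lU; move: lC; clear; lia.
Qed.

Lemma pnat_prod_part (pi : nat_pred) (s : seq nat) : pi.-nat (\prod_(a <- s) a`_pi)%N.
Proof.
apply: (big_ind (fun x => pi.-nat x)) => // [x y px py|a _]; last exact: part_pnat.
by rewrite pnatM px.
Qed.

Lemma dvdn_parts (pi : nat_pred) a x y : (0 < a)%N -> (a`_pi %| x)%N ->
  (a`_pi^' %| y)%N -> (a %| x * y)%N.
Proof. by move=> a0 ax ay; rewrite -[a](partnC pi) // dvdn_mul. Qed.

(** Split every [a] in [A] into the part [a`_pi] composed of primes of [al] and
    the rest.  If infinitely many [a] share the same first part [M], then many of
    them can be made to divide [F n], while [G n] has boundedly many divisors.  If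
    infinitely many [a] share a rest [b] that divides some value of [G], then many
    of them can be made to divide [G n], while [F n] has boundedly many divisors.
    Otherwise, only finitely many [a] have a given first part; let many of them
    divide [F n].  An [a] dividing [G n] then has its first part in a finite list,
    hence is smaller than all primes of the rough part of [G n], so its rest
    divides the constant [K]; and a rest dividing a value of [G] occurs finitely
    often. *)
Lemma gaps_of_triple (R : realType) F G C U V al :
  F != 0 -> G != 0 -> factor_triple F G C U V al -> gaps_unbounded F G.
Proof.
move=> F0 G0 ft A Apos Ainf M0 N0; pose pi : nat_pred := \pi(al).
have [K [B [K0 hK]]] := triple_CU_values R F0 G0 ft.
have [al0 [c c0 FE] _ _ _ _ _ _ _] := ft.
have FCU x y (n : nat) : (x %| `|C.[n%:Z]|)%N -> (y %| `|U.[n%:Z]|)%N ->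
    (x * y %| `|F.[n%:Z]|)%N.
  by move=> h1 h2; rewrite FE !hornerM !abszM dvdn_mull // dvdn_mul.
have countF n (s : seq nat) M L' : uniq s -> F.[n%:Z] != 0 ->
    (forall a, a \in s -> [/\ A a, a`_pi %| M & a`_pi^' %| L']%N) ->
    (M %| `|C.[n%:Z]|)%N -> (L' %| `|U.[n%:Z]|)%N ->
    (size s <= count_divisors A `|F.[n%:Z]|)%N.
  move=> us Fn hs MC LU; apply: leq_count_divisors; rewrite ?absz_gt0 //.
  move=> a /hs[Aa aM aL]; split => //; have a0 := Apos a Aa.
  by apply: dvdn_trans (FCU _ _ _ MC LU); apply: (@dvdn_parts pi).
have [[M Minf]|nI] := pselect
  (exists M, infinite_set [set a | A a /\ (a`_pi)%N = M]%classic).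
  have [s [us sk sA]] := infinite_sample (M0 + size (divisors (M * K)) * B) Minf.
  have MQ : pi.-nat M.
    have [s1 [_ s1k s1A]] := infinite_sample 1 Minf.
    case: s1 s1k s1A => // a s1 _ /(_ a (mem_head _ _)) [_ <-]; exact: part_pnat.
  have M_gt0 : (0 < M)%N by rewrite -(part_pnat_id MQ) part_gt0.
  have [n [u [v [[nN Fn Gn MC LU] [GE uMK vy vB]]]]] :=
    hK M (\prod_(a <- s) a`_pi^')%N N0 MQ (pnat_prod_part _ s).
  exists n; split => //; apply/orP; right.
  have cF := countF n s _ _ us Fn _ MC LU.
  have cG := count_divisors_le A `|G.[n%:Z]|%N.
  have v0 : (0 < v)%N by move: Gn; rewrite -absz_gt0 GE muln_gt0 => /andP[].
  have MK0 : (0 < M * K)%N by rewrite muln_gt0 M_gt0.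
  have dG : (size (divisors `|G.[n%:Z]|) <= size (divisors (M * K)) * B)%N.
    rewrite GE; apply: leq_trans (size_divisorsM (dvdn_gt0 MK0 uMK) v0) _.
    by rewrite leq_mul // leq_size_divisors.
  have : (size s <= count_divisors A `|F.[n%:Z]|)%N.
    apply: cF => a sa; have [Aa aM] := sA a sa; split => //; first by rewrite aM.
    exact: (@dvdn_prod_seq s (fun a => a`_pi^')%N).
  by move: sk cG dG; clear; lia.
have [[b [n0 [binf bG]]]|nII] := pselect (exists b (n0 : int),
    infinite_set [set a | A a /\ (a`_pi^')%N = b]%classic /\ (b %| `|G.[n0]|)%N).
  have bQ : pi^'.-nat b.
    have [s1 [_ s1k s1A]] := infinite_sample 1 binf.
    case: s1 s1k s1A => // a s1 _ /(_ a (mem_head _ _)) [_ <-]; exact: part_pnat.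
  have [K' hK'] := triple_V_values R F0 G0 ft bQ bG.
  have [s [us sk sA]] := infinite_sample (M0 + K') binf.
  have [n [nN Fn Gn bEG dF]] :=
    hK' (\prod_(a <- s) a`_pi)%N N0 (pnat_prod_part _ s).
  exists n; split => //; apply/orP; left.
  have cF := count_divisors_le A `|F.[n%:Z]|%N.
  have : (size s <= count_divisors A `|G.[n%:Z]|)%N.
    apply: leq_count_divisors; rewrite ?absz_gt0 // => a sa.
    have [Aa ab] := sA a sa; split => //; apply: dvdn_trans bEG; rewrite mulnC.
    apply: (@dvdn_parts pi); [exact: Apos| |by rewrite ab].
    exact: (@dvdn_prod_seq s (fun a => a`_pi)%N).
  by move: sk cF dF; clear; lia.
have finQ M : finite_set [set a | A a /\ (a`_pi)%N = M]%classic.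
  by apply: contrapT => h; apply: nI; exists M.
pose Fam := (\bigcup_(b in [set b | (b %| K)%N /\
    finite_set [set a | A a /\ (a`_pi^')%N = b]%classic])
    [set a | A a /\ (a`_pi^')%N = b])%classic.
have finFam : finite_set Fam.
  apply: bigcup_finite => [|b [] //].
  apply: (@sub_finite_set _ _ [set` [fset b in divisors K]%fset]%classic).
    by move=> b [bK _]; rewrite /= inE -dvdn_divisors.
  exact: finite_fset.
pose f0 := #|` fset_set Fam|.
have [s [us sk sA]] := infinite_sample (M0 + f0) Ainf.
pose M := (\prod_(a <- s) a`_pi)%N.
have MQ : pi.-nat M by apply: pnat_prod_part.
have M_gt0 : (0 < M)%N by rewrite -(part_pnat_id MQ) part_gt0.
have MK0 : (0 < M * K)%N by rewrite muln_gt0 M_gt0.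
pose A0 := (\bigcup_(d in [set d | (d %| M * K)%N])
  [set a | A a /\ (a`_pi)%N = d])%classic.
have finA0 : finite_set A0.
  apply: bigcup_finite => // .
  apply: (@sub_finite_set _ _ [set` [fset b in divisors (M * K)]%fset]%classic).
    by move=> b bK; rewrite /= inE -dvdn_divisors.
  exact: finite_fset.
(* [y1] also exceeds the primes of [al], to keep them out of [v] *)
pose y1 := (N0 + al + \sum_(a <- fset_set A0) a)%N.
have A0y a : A0 a -> (a <= y1)%N.
  move=> A0a; have ain : a \in fset_set A0 by rewrite in_fset_set // inE.
  by rewrite /y1 (big_rem a) //= addnCA leq_addr.
have [n [u [v [[nN Fn Gn MC LU] [GE uMK vy vB]]]]] :=
  hK M (\prod_(a <- s) a`_pi^')%N y1 MQ (pnat_prod_part _ s).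
have v0 : (0 < v)%N by move: Gn; rewrite -absz_gt0 GE muln_gt0 => /andP[].
exists n; split => //; first by apply: leq_trans nN; rewrite /y1 -addnA leq_addr.
apply/orP; right.
have cF : (size s <= count_divisors A `|F.[n%:Z]|)%N.
  apply: (countF n s _ _ us Fn _ MC LU) => a sa; split; first exact: sA.
    exact: (@dvdn_prod_seq s (fun a => a`_pi)%N).
  exact: (@dvdn_prod_seq s (fun a => a`_pi^')%N).
have cov x : (0 < x <= y1)%N -> coprime x v.
  move=> /andP[x0 xy]; rewrite coprime_has_primes //; apply/hasPn => p.
  rewrite !mem_primes => /and3P[pp _ pv]; apply/negP => /and3P[_ _ /(dvdn_leq x0) px].
  by move: (vy p pp pv); rewrite ltnNge (leq_trans px xy).
have cG : (count_divisors A `|G.[n%:Z]| <= f0)%N.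
  apply: count_divisors_sub; rewrite ?absz_gt0 // => a Aa aG.
  have a0 := Apos a Aa.
  have aQu : (a`_pi %| M * K)%N.
    apply: dvdn_trans uMK; rewrite -(@Gauss_dvdl _ _ v).
      by rewrite -GE; apply: dvdn_trans aG; apply: dvdn_part.
    apply: (@pnat_coprime pi); first exact: part_pnat.
    apply/pnatP => // p pp pv; rewrite inE /= mem_primes pp al0 /=.
    apply/negP => /(dvdn_leq al0) pal; have := vy p pp pv; rewrite ltnNge => /negP.
    by apply; apply: leq_trans pal _; rewrite /y1 -addnA addnCA leq_addr.
  have ay : (a <= y1)%N by apply: A0y; exists (a`_pi)%N.
  have au : (a %| M * K)%N.
    apply: dvdn_trans uMK; rewrite -(@Gauss_dvdl _ _ v) -?GE //.
    by apply: cov; rewrite a0.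
  have a'K : (a`_pi^' %| K)%N.
    rewrite -(@Gauss_dvdr _ M); first by apply: dvdn_trans au; apply: dvdn_part.
    by rewrite coprime_sym; apply: pnat_coprime MQ (part_pnat _ _).
  rewrite in_fset_set // inE; exists (a`_pi^')%N => //; split => //.
  apply: contrapT => inf; apply: nII; exists (a`_pi^')%N, n%:Z; split => //.
  by apply: dvdn_trans aG; apply: dvdn_part.
by move: sk cF cG; clear; lia.
Qed.

(** * Necessity *)

Lemma unbounded_infinite_set (A : set nat) :
  (forall b, exists2 a, A a & (b < a)%N) -> infinite_set A.
Proof.
move=> h fA; have [a Aa] := h (\sum_(x <- fset_set A) x)%N.
have ain : a \in fset_set A by rewrite in_fset_set // inE.
by rewrite (big_rem a) //= ltnNge leq_addr.
Qed.

Lemma intersectiveP (H : {poly int}) :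
  intersective H <-> forall m, (0 < m)%N -> exists n : nat, (m %| `|H.[n%:Z]|)%N.
Proof.
split=> [h m m0|h m m0].
  by have [n hn] := intersective_nat m0 h; exists n; move: hn; rewrite dvdzE.
have [n hn] := h m m0; exists n%:Z; apply/eqP.
by rewrite eqz_mod_dvd subr0 dvdzE.
Qed.

(** The Chinese remainder theorem, splitting off one prime at a time. *)
Lemma intersective_local (H : {poly int}) :
  (forall p k, prime p -> exists n : nat, (p ^ k %| `|H.[n%:Z]|)%N) ->
  intersective H.
Proof.
move=> h; apply/intersectiveP => m; have [b] := ubnP m.
elim: b m => // b IH m; rewrite ltnS => mb m0.
have [m1|m1] := leqP m 1; first by exists 0%N; rewrite (_ : m = 1%N) ?dvd1n //; lia.
pose p := pdiv m; have pp : prime p by apply: pdiv_prime.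
have pm : (1 < m`_p)%N.
  by rewrite p_part -(exp1n (logn p m)) ltn_exp2r ?prime_gt1 // logn_gt0 pi_pdiv.
have mE := partnC p m0.
have lt : (m`_p^' < m)%N.
  by rewrite -[X in (_ < X)%N]mE -[X in (X < _)%N]mul1n ltn_pmul2r // part_gt0.
have [n2 hn2] := IH (m`_p^')%N (leq_trans lt mb) (part_gt0 _ _).
have [n1] := h p (logn p m) pp; rewrite -p_part => hn1.
have co := coprime_partC p m m.
exists (chinese m`_p m`_p^' n1 n2)%N.
rewrite -[X in (X %| _)%N]mE Gauss_dvd //; apply/andP; split.
  by move: hn1; have := dvdz_horner_mod H (chinese_modl co n1 n2); rewrite !dvdzE => ->.
by move: hn2; have := dvdz_horner_mod H (chinese_modr co n1 n2); rewrite !dvdzE => ->.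
Qed.

Lemma count_divisors0 (A : set nat) m :
  (0 < m)%N -> (forall a, A a -> ~~ (a %| m)%N) -> count_divisors A m = 0%N.
Proof.
move=> m0 h; apply/eqP; rewrite -leqn0; apply: (@count_divisors_sub A m [::]) => //.
by move=> a /h /negPf ->.
Qed.

(** Test with the multiples of [m1 * m2], where [F] has no zero modulo [m1] and
    [G] none modulo [m2]. *)
Lemma gaps_unbounded_intersective (F G : {poly int}) :
  gaps_unbounded F G -> intersective F \/ intersective G.
Proof.
move=> gap; apply: contrapT => /not_orP[nF nG].
have wit H : ~ intersective H -> exists2 m, (0 < m)%N &
    forall n : nat, ~~ (m %| `|H.[n%:Z]|)%N.
  move=> nH; apply: contrapT => nex; apply/nH/intersectiveP => m m0.
  apply: contrapT => nn; apply: nex; exists m => // n.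
  by apply/negP => mn; apply: nn; exists n.
have [m1 m10 h1] := wit F nF; have [m2 m20 h2] := wit G nG.
pose A : set nat := [set a | (0 < a)%N /\ (m1 * m2 %| a)%N]%classic.
have Ainf : infinite_set A.
  apply: unbounded_infinite_set => b; exists (m1 * m2 * b.+1)%N.
    by split; rewrite ?muln_gt0 ?m10 ?m20 // dvdn_mulr.
  by rewrite -[X in (X <= _)%N]mul1n leq_mul2r muln_gt0 m10 m20 orbT.
have [n [_ Fn Gn]] := gap A (fun a h => h.1) Ainf 1%N 0%N.
rewrite !count_divisors0 ?absz_gt0 // => a [_ ma].
  apply: contra (h2 n); apply: dvdn_trans; apply: dvdn_trans ma; exact: dvdn_mull.
apply: contra (h1 n); apply: dvdn_trans; apply: dvdn_trans ma; exact: dvdn_mulr.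
Qed.

Fixpoint lacunary (K E i : nat) : nat :=
  if i is j.+1 then (K + E.+1 * lacunary K E j).+1 else 0.

Lemma lacunary_ge K E i : (i <= lacunary K E i)%N.
Proof. by elim: i => //= i IH; rewrite ltnS; nia. Qed.

Definition lacunary_powers p K E : set nat :=
  [set a | exists i, a = p ^ lacunary K E i]%classic%N.

(** Each lacunary power dividing [m1], except the first, has a predecessor
    dividing [m2]. *)
Lemma count_lacunary_le p K E m1 m2 : prime p -> (0 < m1)%N -> (0 < m2)%N ->
  (forall s, (p ^ (K + E.+1 * s).+1 %| m1)%N -> (p ^ s %| m2)%N) ->
  (count_divisors (lacunary_powers p K E) m1 <=
     (count_divisors (lacunary_powers p K E) m2).+1)%N.
Proof.
move=> pp m10 m20 h; set A := lacunary_powers p K E.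
pose next b := (p ^ (K + E.+1 * logn p b).+1)%N.
have -> : (count_divisors A m2).+1 =
    size (1%N :: map next [seq b <- divisors m2 | `[< A b >]]).
  by rewrite /= size_map.
apply: count_divisors_sub => // a [[|i] ->] am; rewrite inE; first by rewrite eqxx.
apply/orP; right; apply/mapP; exists (p ^ lacunary K E i)%N.
  rewrite mem_filter -dvdn_divisors // h // andbT.
  by apply/asboolP; exists i.
by rewrite /next pfactorK.
Qed.

(** The [p]-adic valuations of [U n] and [V n] are less than [k], so those of
    [F n] and [G n] lie between that of [C n] and an affine function of it.  The
    lacunary set of powers of [p] adapted to this affine function meets the
    divisors of [F n] and of [G n] in almost the same number of elements. *)
Lemma gaps_bounded_at_prime (F G C U V : {poly int}) (c E p k : nat) :
  prime p -> (0 < c)%N ->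
  (forall n : nat, `|C.[n%:Z]| %| `|F.[n%:Z]|)%N ->
  (forall n : nat, `|C.[n%:Z]| %| `|G.[n%:Z]|)%N ->
  (forall n : nat, `|F.[n%:Z]| %| c * (`|C.[n%:Z]| * `|U.[n%:Z]|) ^ E)%N ->
  (forall n : nat, `|G.[n%:Z]| %| c * (`|C.[n%:Z]| * `|V.[n%:Z]|) ^ E)%N ->
  (forall n : nat, ~~ (p ^ k %| `|(U * V).[n%:Z]|)%N) ->
  ~ gaps_unbounded F G.
Proof.
move=> pp c0 CF CG FC GC nUV gap.
pose K := (logn p c + E * k)%N; pose A := lacunary_powers p K E.
have Apos a : A a -> (0 < a)%N by case=> i ->; rewrite expn_gt0 prime_gt0.
have Ainf : infinite_set A.
  apply: unbounded_infinite_set => b; exists (p ^ lacunary K E b)%N; first by exists b.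
  apply: leq_trans (ltn_expl _ (prime_gt1 pp)) _.
  by rewrite leq_exp2l ?prime_gt1 ?lacunary_ge.
have [n [_ Fn Gn]] := gap A Apos Ainf 2%N 0%N.
have step (H W : {poly int}) : H.[n%:Z] != 0 -> (`|W.[n%:Z]| %| `|(U * V).[n%:Z]|)%N ->
    (`|C.[n%:Z]| %| `|H.[n%:Z]|)%N ->
    (`|H.[n%:Z]| %| c * (`|C.[n%:Z]| * `|W.[n%:Z]|) ^ E)%N ->
    forall s, (p ^ (K + E.+1 * s).+1 %| `|H.[n%:Z]|)%N -> (p ^ s %| `|C.[n%:Z]|)%N.
  move=> Hn WUV CH HC s hs.
  have Hn0 : (0 < `|H.[n%:Z]|)%N by rewrite absz_gt0.
  have Cn0 : (0 < `|C.[n%:Z]|)%N := dvdn_gt0 Hn0 CH.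
  have nW : ~~ (p ^ k %| `|W.[n%:Z]|)%N by apply: contra (nUV n) => /dvdn_trans; apply.
  have Wn0 : (0 < `|W.[n%:Z]|)%N by rewrite lt0n; apply: contraNneq nW => ->.
  move: nW; rewrite pfactor_dvdn // -ltnNge => lW.
  have CW0 : (0 < `|C.[n%:Z]| * `|W.[n%:Z]|)%N by rewrite muln_gt0 Cn0.
  have := dvdn_trans hs HC; rewrite !pfactor_dvdn ?muln_gt0 ?c0 ?expn_gt0 ?CW0 //.
  rewrite lognM ?expn_gt0 ?CW0 // lognX lognM // /K.
  by move: lW; clear; nia.
have hF : forall s, (p ^ (K + E.+1 * s).+1 %| `|F.[n%:Z]|)%N -> (p ^ s %| `|G.[n%:Z]|)%N.
  move=> s hs; apply: dvdn_trans (CG n); apply: (step F U) hs => //.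
  by rewrite hornerM abszM dvdn_mulr.
have hG : forall s, (p ^ (K + E.+1 * s).+1 %| `|G.[n%:Z]|)%N -> (p ^ s %| `|F.[n%:Z]|)%N.
  move=> s hs; apply: dvdn_trans (CF n); apply: (step G V) hs => //.
  by rewrite hornerM abszM dvdn_mull.
have Fn0 : (0 < `|F.[n%:Z]|)%N by rewrite absz_gt0.
have Gn0 : (0 < `|G.[n%:Z]|)%N by rewrite absz_gt0.
have := count_lacunary_le pp Fn0 Gn0 hF; have := count_lacunary_le pp Gn0 Fn0 hG.
by rewrite -/A /far_apart; clear; lia.
Qed.

(** * Supports *)

Lemma primitive_unit (r : {poly int}) :
  r \is a GRing.unit -> zcontents r = 1 -> r = 1.
Proof.
rewrite poly_unitE => /andP[/eqP sr _]; rewrite [r]size1_polyC ?sr //.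
rewrite -[X in zcontents X]mulr1 mul_polyC zcontentsZ zcontents_monic ?monic1 //.
by rewrite mulr1 => ->.
Qed.

(** By the Gauss lemma, the primitive part of [d] divides [phi] over the
    integers. *)
Lemma prime_factor_eq (d phi : {poly int}) :
  prime_factor phi -> (1 < size d)%N -> Pdiv.Idomain.dvdp d phi -> phi = zprimitive d.
Proof.
move=> [sphi cphi [phi0 _ irr]] sd /dvdpP_int[r E].
have d0 : d != 0 by apply: contraTneq sd => ->; rewrite size_poly0.
case: (irr _ _ E) => [|ru].
  by rewrite poly_unitE size_zprimitive gtn_eqF.
move: cphi; rewrite E zcontentsM zcontents_primitive d0 mul1r => cr.
by rewrite (primitive_unit ru cr) mulr1.
Qed.

(** The resultant provides the Bezout relation; it vanishes only if there is a
    common factor, whose primitive part would be equal to both. *)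
Lemma prime_factors_almost_coprime (phi psi : {poly int}) :
  prime_factor phi -> prime_factor psi -> phi != psi -> almost_coprime phi psi.
Proof.
move=> pphi ppsi ne; have [sphi _ _] := pphi; have [spsi _ _] := ppsi.
have [[u v] _ /= E] := resultant_in_ideal sphi spsi.
exists `|resultant phi psi|%N.
  rewrite absz_gt0 resultant_eq0; apply/negP => sg.
  move/negP: ne; apply; apply/eqP.
  apply: etrans (prime_factor_eq pphi sg (Pdiv.Idomain.dvdp_gcdl _ _)) _.
  exact: esym (prime_factor_eq ppsi sg (Pdiv.Idomain.dvdp_gcdr _ _)).
move=> n d dphi dpsi; have := congr1 (fun P : {poly int} => P.[n]) E.
rewrite !hornerE => ->; rewrite -[d]/`|d%:Z|%N -dvdzE.
by rewrite rpredD // dvdz_mull // dvdzE.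
Qed.

Lemma almost_coprimeX P Q e : almost_coprime P Q -> almost_coprime P (Q ^+ e).
Proof.
move=> PQ; elim: e => [|e IH]; first exact: almost_coprime1.
by rewrite exprS; apply: almost_coprimeM.
Qed.

Lemma almost_coprime_prod P (I : {fset {poly int}}) (f : {poly int} -> {poly int}) :
  (forall phi, phi \in I -> almost_coprime P (f phi)) ->
  almost_coprime P (\prod_(phi <- I) f phi).
Proof.
move=> h; rewrite big_seq; apply: (big_ind (almost_coprime P)) => //.
- exact: almost_coprime1.
- by move=> Q1 Q2; apply: almost_coprimeM.
Qed.

Lemma support_prod_almost_coprime (I J : {fset {poly int}}) c e :
  c != 0 ->
  (forall phi, phi \in I -> prime_factor phi) ->
  (forall phi, phi \in J -> prime_factor phi) ->
  (forall phi, phi \in I -> phi \notin J) ->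
  almost_coprime (support_prod I) (c%:P * \prod_(phi <- J) phi ^+ e phi).
Proof.
move=> c0 pI pJ dis; apply: almost_coprimeM; first exact: almost_coprime_const.
apply: almost_coprime_prod => psi psiJ; apply: almost_coprimeX.
apply: almost_coprimeC; apply: almost_coprime_prod => phi phiI.
apply: prime_factors_almost_coprime; [exact: pJ|exact: pI|].
by apply: contraTneq psiJ => ->; apply: dis.
Qed.

Lemma support_prodID (I J : {fset {poly int}}) :
  support_prod I = support_prod (I `&` J)%fset * support_only I J.
Proof.
rewrite /support_only /support_prod (@big_fsetID _ _ _ _ (mem J) I).
congr (_ * _); apply: congr_big => //; congr enum_fset; apply/fsetP => phi;
  by rewrite !inE // andbC.
Qed.

Lemma support_prod_neq0 (I : {fset {poly int}}) :
  (forall phi, phi \in I -> prime_factor phi) -> support_prod I != 0.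
Proof.
move=> h; rewrite /support_prod big_seq.
apply: (big_ind (fun P => P != 0)); first exact: oner_neq0.
  by move=> P Q P0 Q0; rewrite mulf_neq0.
by move=> phi /h[_ _ []].
Qed.

Lemma zcontents_support_prod (I : {fset {poly int}}) :
  (forall phi, phi \in I -> prime_factor phi) -> zcontents (support_prod I) = 1.
Proof.
move=> h; rewrite /support_prod big_seq.
apply: (big_ind (fun P => zcontents P = 1)); first exact: zcontents_monic (monic1 _).
  by move=> P Q; rewrite zcontentsM => -> ->; rewrite mulr1.
by move=> phi /h[].
Qed.

Lemma support_prod_trivial (I : {fset {poly int}}) :
  (forall phi, phi \in I -> prime_factor phi) ->
  I = fset0 \/ (1 < size (support_prod I))%N.
Proof.
move=> h; have [->|/fset0Pn[phi phiI]] := eqVneq I fset0; first by left.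
right; have := support_prod_neq0 h; rewrite /support_prod (big_rem phi) //=.
set Q := \prod_(_ <- _) _; rewrite mulf_eq0 negb_or => /andP[phi0 Q0].
have [s1 _ _] := h phi phiI; rewrite size_mul //.
have sQ : (0 < size Q)%N by rewrite size_poly_gt0.
by apply: leq_trans s1 _; case: (size Q) sQ => // k _; rewrite addnS leq_addr.
Qed.

Lemma support_dvd (P : {poly int}) (I : {fset {poly int}}) :
  is_support P I -> exists Q, P = Q * support_prod I.
Proof.
move=> [_ [c [e [c0 e1 ->]]]].
exists (c%:P * \prod_(phi <- I) phi ^+ (e phi).-1).
rewrite -mulrA /support_prod -big_split; congr (_ * _) => /=.
rewrite big_seq [RHS]big_seq; apply: eq_bigr => phi /e1.
by case: (e phi) => // k _; rewrite exprSr.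
Qed.

Lemma support_dvd_val (P : {poly int}) (I : {fset {poly int}}) (n : int) :
  is_support P I -> (`|(support_prod I).[n]| %| `|P.[n]|)%N.
Proof. by case/support_dvd => Q ->; rewrite hornerM abszM dvdn_mull. Qed.

(** Raising the radical to the sum of all exponents makes it a multiple of [P] up
    to the constant. *)
Lemma support_pow_val (P : {poly int}) (I : {fset {poly int}}) :
  is_support P I -> exists c E, (0 < c)%N /\
  forall n : int, (`|P.[n]| %| c * `|(support_prod I).[n]| ^ E)%N.
Proof.
move=> [_ [c [e [c0 e1 PE]]]].
pose E := (\sum_(phi <- I) e phi)%N.
exists `|c|%N, E; split; first by rewrite absz_gt0.
move=> n; have : exists Q, c%:P * support_prod I ^+ E = Q * P.
  exists (\prod_(phi <- I) phi ^+ (E - e phi)).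
  rewrite PE mulrCA; congr (_ * _); rewrite /support_prod -prodrXl -big_split /=.
  rewrite big_seq [RHS]big_seq; apply: eq_bigr => phi phiI.
  by rewrite -exprD subnK // /E (big_rem phi) //= leq_addr.
case=> Q /(congr1 (fun R : {poly int} => `|R.[n]|%N)).
rewrite !hornerM hornerC horner_exp !abszM abszX => ->.
exact: dvdn_mull.
Qed.

Lemma intersective_support (P : {poly int}) (I : {fset {poly int}}) :
  is_support P I -> (intersective P <-> intersective (support_prod I)).
Proof.
move=> sP; split=> /intersectiveP h; apply/intersectiveP => m m0; last first.
  have [n hn] := h m m0; exists n; exact: dvdn_trans hn (support_dvd_val _ sP).
have [c [E [c0 hE]]] := support_pow_val sP.
have [|n hn] := h (c * m ^ E.+1)%N; first by rewrite muln_gt0 c0 expn_gt0 m0.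
exists n; have := dvdn_trans hn (hE n%:Z); rewrite dvdn_pmul2l //.
move=> /dvdn_trans/(_ (dvdn_exp2l _ (leqnSn E))).
by rewrite dvdn_pexp2r.
Qed.

(** * Primitive linear polynomials *)

Definition primitive_linear (P : {poly int}) := size P = 2%N /\ zcontents P = 1.

Lemma linear_horner (P : {poly int}) (n : int) :
  size P = 2%N -> P.[n] = lead_coef P * n + P`_0.
Proof.
by move=> sP; rewrite lead_coefE horner_coef sP !big_ord_recl big_ord0 /=
  expr0 expr1 mulr1  addr0 addrC.
Qed.

Lemma primitive_linear_lead_gt0 P : primitive_linear P -> (0 < `|lead_coef P|)%N.
Proof.
by move=> [sP _]; rewrite absz_gt0 lead_coef_eq0 -size_poly_eq0 sP.
Qed.

(** Otherwise [q] would divide both coefficients. *)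
Lemma primitive_linear_nonroot P q (n : int) : primitive_linear P ->
  prime q -> (q %| `|lead_coef P|)%N -> ~~ (q %| `|P.[n]|)%N.
Proof.
move=> [sP cP] pq q1; apply/negP; rewrite linear_horner // => q0.
have h1 : (q%:Z %| lead_coef P)%Z by rewrite dvdzE.
have h0 : (q%:Z %| P`_0)%Z.
  have : (q%:Z %| lead_coef P * n + P`_0)%Z by rewrite dvdzE.
  by rewrite rpredDl // dvdz_mulr.
have : (q%:Z %| zcontents P)%Z.
  rewrite dvdz_contents; apply/polyOverP => -[|[|i]] //.
    by move: h1; rewrite lead_coefE sP.
  by rewrite nth_default ?sP // dvdz0.
by rewrite cP dvdzE /= dvdn1 => /eqP q1'; rewrite q1' in pq.
Qed.

Lemma primitive_linear_solve P m w : primitive_linear P -> (0 < m)%N ->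
  coprime m `|lead_coef P| -> exists n : nat, (m%:Z %| P.[n%:Z] - w%:Z)%Z.
Proof.
move=> [sP _] m0 co; have [u [v E]] := Bezoutz m%:Z (lead_coef P).
have {}E : u * m%:Z + v * lead_coef P = 1 by rewrite E /gcdz /= (eqP co).
pose n0 := v * (w%:Z - P`_0).
have n0P : (m%:Z %| P.[n0] - w%:Z)%Z.
  rewrite linear_horner // /n0.
  have -> : lead_coef P * (v * (w%:Z - P`_0)) + P`_0 - w%:Z =
      (v * lead_coef P - (u * m%:Z + v * lead_coef P)) * (w%:Z - P`_0).
    by rewrite E; ring.
  have -> : v * lead_coef P - (u * m%:Z + v * lead_coef P) = - (u * m%:Z) by ring.
  by rewrite mulNr rpredN mulrAC dvdz_mull.
exists `|(n0 %% m%:Z)%Z|%N; rewrite gez0_abs ?modz_ge0 // -?lt0n //.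
rewrite -(subrK P.[n0] P.[_]) -addrA rpredD // horner_congr //.
by rewrite -eqz_mod_dvd modz_mod.
Qed.

(** A prime dividing both [al] and the leading coefficient of [C] would be one
    modulo which neither [U] nor [C] has a zero. *)
Lemma coprime_lead_of_intersective (C U : {poly int}) c al m :
  primitive_linear C -> c != 0 -> (0 < al)%N ->
  (forall q (n : int), prime q -> (q %| al)%N -> ~~ (q %| `|U.[n]|)%N) ->
  intersective (c%:P * (C * U)) -> \pi(al).-nat m -> coprime m `|lead_coef C|.
Proof.
move=> lC c0 al0 hU /intersectiveP hi mQ.
have m0 := part_gt0 \pi(al) m; rewrite part_pnat_id // in m0.
have C10 := primitive_linear_lead_gt0 lC.
rewrite coprime_has_primes //; apply/hasPn => p.
rewrite mem_primes => /and3P[pp _ pC]; apply/negP => /= pm.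
have := pnatPpi mQ pm; rewrite mem_pi_al // => pal.
have [|n] := hi (`|c| * p)%N; first by rewrite muln_gt0 absz_gt0 c0 prime_gt0.
rewrite hornerM hornerC abszM dvdn_pmul2l ?absz_gt0 // hornerM abszM Euclid_dvdM //.
by rewrite (negPf (primitive_linear_nonroot _ lC pp pC)) (negPf (hU _ _ pp pal)).
Qed.

Lemma linear_factor_triple (F G C U V : {poly int}) c c' :
  primitive_linear C -> primitive_linear U ->
  primitive_linear V -> c != 0 -> c' != 0 ->
  F = c%:P * (C * U) -> G = c'%:P * (C * V) ->
  almost_coprime U G -> almost_coprime C V ->
  intersective (U * V) -> intersective F ->
  factor_triple F G C U V `|lead_coef U|.
Proof.
move=> lC lU lV c0 c'0 FE GE UG CV iUV iF.
have al0 := primitive_linear_lead_gt0 lU.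
have hUq q (n : int) : prime q -> (q %| `|lead_coef U|)%N -> ~~ (q %| `|U.[n]|)%N.
  by move=> pq qU; apply: primitive_linear_nonroot.
have iVU : intersective (1%:P * (V * U)) by rewrite mul1r mulrC.
have solve P w : primitive_linear P ->
    forall m, (0 < m)%N -> coprime m `|lead_coef P| ->
    exists n : nat, (m%:Z %| P.[n%:Z] - w%:Z)%Z.
  by move=> lP m m0 co; apply: primitive_linear_solve.
have Qgt0 m : \pi(`|lead_coef U|%N).-nat m -> (0 < m)%N.
  by move=> mQ; rewrite -(part_pnat_id mQ) part_gt0.
split => //.
- by exists c.
- by exists c'.
- by move=> m m0 co; have [n] := solve U 0%N lU m m0 co; rewrite subr0; exists n.
- move=> m w mQ; apply: solve => //; first exact: Qgt0.
  by apply: (coprime_lead_of_intersective lC c0 al0 hUq _ mQ); rewrite -FE.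
- move=> m mQ; have [||n] := solve V 0%N lV m; first exact: Qgt0.
    exact: (coprime_lead_of_intersective lV (oner_neq0 int) al0 hUq iVU mQ).
  by rewrite subr0; exists n.
Qed.

(** * The criterion *)

Lemma size_cofactor (P Q S : {poly int}) : P != 0 -> P = Q * S ->
  (size S <= size P)%N /\ ((size P <= size S)%N -> exists2 c, c != 0 & P = c%:P * S).
Proof.
move=> P0 E; have [Q0 S0] : Q != 0 /\ S != 0.
  by apply/andP; rewrite -negb_or -mulf_eq0 -E.
have sQ : (0 < size Q)%N by rewrite size_poly_gt0.
have sS : (0 < size S)%N by rewrite size_poly_gt0.
have sE : size P = (size Q + size S).-1 by rewrite E size_mul.
split.
  by rewrite sE; case: (size Q) sQ => // k _; rewrite addSn leq_addl.
move=> le; have s1 : (size Q <= 1)%N.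
  move: le sQ sS; rewrite sE; move: (size Q) (size S) => x y; clear; lia.
exists Q`_0; last by rewrite -(size1_polyC s1).
by apply: contraNneq Q0 => Q00; rewrite (size1_polyC s1) Q00.
Qed.

(** If [C] is constant, [U] is the radical of [F] and hence intersective; if [U]
    or [V] is constant, the other one is intersective.  Otherwise the degrees
    leave room for linear [C], [U] and [V] only. *)
Lemma gaps_sufficient (R : realType) (F G : {poly int}) (IF IG : {fset {poly int}}) :
  F != 0 -> G != 0 -> (size F <= 3)%N -> (size G <= 3)%N ->
  is_support F IF -> is_support G IG ->
  intersective (support_only IF IG * support_only IG IF) -> intersective F ->
  gaps_unbounded F G.
Proof.
move=> F0 G0 sF sG spF spG; set U := support_only IF IG; set V := support_only IG IF.
move=> iUV iF; pose C := support_prod (IF `&` IG)%fset.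
have [pF _] := spF; have [pG _] := spG.
have pU phi : phi \in (IF `\` IG)%fset -> prime_factor phi.
  by rewrite inE => /andP[_]; apply: pF.
have pV phi : phi \in (IG `\` IF)%fset -> prime_factor phi.
  by rewrite inE => /andP[_]; apply: pG.
have pC phi : phi \in (IF `&` IG)%fset -> prime_factor phi.
  by rewrite inE => /andP[/pF].
have radF : support_prod IF = C * U by apply: support_prodID.
have radG : support_prod IG = C * V by rewrite /C fsetIC; apply: support_prodID.
have UF (n : int) : (`|U.[n]| %| `|F.[n]|)%N.
  by apply: dvdn_trans (support_dvd_val n spF); rewrite radF hornerM abszM dvdn_mull.
have VG (n : int) : (`|V.[n]| %| `|G.[n]|)%N.
  by apply: dvdn_trans (support_dvd_val n spG); rewrite radG hornerM abszM dvdn_mull.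
have UG : almost_coprime U G.
  have [_ [c [e [c0 _ ->]]]] := spG; apply: support_prod_almost_coprime => //.
  by move=> phi; rewrite inE => /andP[].
have VF : almost_coprime V F.
  have [_ [c [e [c0 _ ->]]]] := spF; apply: support_prod_almost_coprime => //.
  by move=> phi; rewrite inE => /andP[].
have CV : almost_coprime C V.
  have := @support_prod_almost_coprime (IF `&` IG)%fset (IG `\` IF)%fset 1
    (fun=> 1%N) (oner_neq0 _) pC pV.
  rewrite mul1r; under eq_bigr do rewrite expr1; apply.
  by move=> phi; rewrite !inE => /andP[->].
have only_U : intersective U -> gaps_unbounded F G.
  by move=> iU; apply: (gaps_of_intersective_part R F0 G0 iU UF UG).
have only_V : intersective V -> gaps_unbounded F G.
  move=> iV; apply: gaps_unboundedC.
  exact: (gaps_of_intersective_part R G0 F0 iV VG VF).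
have [C1|sC] := support_prod_trivial pC.
  apply: only_U; have := (intersective_support spF).1 iF.
  by rewrite radF /C C1 /support_prod big_nil mul1r.
have [U1|sU] := support_prod_trivial pU.
  by apply: only_V; move: iUV; rewrite {1}/U /support_only U1 /support_prod big_nil mul1r.
have [V1|sV] := support_prod_trivial pV.
  by apply: only_U; move: iUV; rewrite {1}/V /support_only V1 /support_prod big_nil mulr1.
rewrite -/C -/(support_only _ _) -/U -/V in sC sU sV.
have [QF EF] := support_dvd spF; rewrite radF in EF.
have [QG EG] := support_dvd spG; rewrite radG in EG.
have C0 : C != 0 by apply: support_prod_neq0.
have U0 : U != 0 by apply: support_prod_neq0.
have V0 : V != 0 by apply: support_prod_neq0.
have [leF hF] := size_cofactor F0 EF; have [leG hG] := size_cofactor G0 EG.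
rewrite size_mul // in leF hF; rewrite size_mul // in leG hG.
have [sC2 sU2 sV2] : [/\ size C = 2, size U = 2 & size V = 2]%N.
  move: leF leG sF sG sC sU sV; clear.
  move: (size C) (size U) (size V) (size F) (size G) => x y z f g *.
  by split; lia.
rewrite sC2 sU2 in hF; rewrite sC2 sV2 in hG.
have [c c0 FE] := hF sF; have [c' c'0 GE] := hG sG.
have lC : primitive_linear C by split; rewrite ?zcontents_support_prod.
have lU : primitive_linear U by split; rewrite ?zcontents_support_prod.
have lV : primitive_linear V by split; rewrite ?zcontents_support_prod.
apply: (@gaps_of_triple R _ _ _ _ _ _ F0 G0).
exact: (linear_factor_triple lC lU lV c0 c'0 FE GE UG CV iUV iF).
Qed.

Lemma gaps_necessary (F G : {poly int}) (IF IG : {fset {poly int}}) :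
  is_support F IF -> is_support G IG -> gaps_unbounded F G ->
  intersective (support_only IF IG * support_only IG IF).
Proof.
move=> spF spG gap; apply: intersective_local => p k pp.
apply: contrapT => nex.
have radF := support_prodID IF IG; have radG := support_prodID IG IF.
rewrite fsetIC in radG; set C := support_prod (IF `&` IG)%fset in radF radG.
have [c1 [E1 [c10 h1]]] := support_pow_val spF.
have [c2 [E2 [c20 h2]]] := support_pow_val spG.
apply: (@gaps_bounded_at_prime F G C _ _ (c1 * c2) (E1 + E2) p k pp _ _ _ _ _ _ gap).
- by rewrite muln_gt0 c10.
- move=> n; apply: dvdn_trans (support_dvd_val n spF).
  by rewrite radF hornerM abszM dvdn_mulr.
- move=> n; apply: dvdn_trans (support_dvd_val n spG).
  by rewrite radG hornerM abszM dvdn_mulr.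
- move=> n; apply: dvdn_trans (h1 n) _; rewrite radF hornerM abszM expnD.
  by rewrite mulnACA dvdn_mulr.
- move=> n; apply: dvdn_trans (h2 n) _; rewrite radG hornerM abszM expnD.
  by rewrite mulnACA dvdn_mull.
by move=> n; apply/negP => h; apply: nex; exists n.
Qed.

Lemma unbounded_gaps_criterion (R : realType) (F G : {poly int})
    (IF IG : {fset {poly int}}) :
  F != 0 -> G != 0 -> (size F <= 3)%N -> (size G <= 3)%N ->
  is_support F IF -> is_support G IG ->
  unbounded_gaps R F G <->
    intersective (support_only IF IG * support_only IG IF) /\
    (intersective F \/ intersective G).
Proof.
move=> F0 G0 sF sG spF spG; split.
  move/(unbounded_gapsP R F0 G0) => gap; split; first exact: gaps_necessary spF spG gap.
  exact: gaps_unbounded_intersective gap.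
move=> [iUV iFG]; apply/unbounded_gapsP => //.
case: iFG => [iF|iG]; first exact: (gaps_sufficient R F0 G0 sF sG spF spG iUV iF).
apply: gaps_unboundedC; rewrite mulrC in iUV.
exact: (gaps_sufficient R G0 F0 sG sF spG spF iUV iG).
Qed.

Lemma support_prod_support (I : {fset {poly int}}) :
  (forall phi, phi \in I -> prime_factor phi) -> is_support (support_prod I) I.
Proof.
move=> h; split=> //; exists 1, (fun=> 1%N); split => //.
by rewrite mul1r; under [RHS]eq_bigr do rewrite expr1.
Qed.

Theorem corollary1p6 (R : realType) (F G : {poly int})
    (IF IG : {fset {poly int}}) :
  F != 0 -> G != 0 ->
  (size F <= 3)%N -> (size G <= 3)%N ->
  is_support F IF -> is_support G IG ->
  let U := support_only IF IG in
  let V := support_only IG IF in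
  (unbounded_gaps R F G <->
     intersective (U * V) /\ (intersective F \/ intersective G)) /\
  (unbounded_gaps R F G <->
     unbounded_gaps R (support_prod IF) (support_prod IG)).
Proof.
move=> F0 G0 sF sG spF spG U V.
have crit := unbounded_gaps_criterion R F0 G0 sF sG spF spG.
split; first exact: crit.
have [pF _] := spF; have [pG _] := spG.
have [QF EF] := support_dvd spF; have [QG EG] := support_dvd spG.
have sradF := leq_trans (size_cofactor F0 EF).1 sF.
have sradG := leq_trans (size_cofactor G0 EG).1 sG.
have crit' := unbounded_gaps_criterion R (support_prod_neq0 pF) (support_prod_neq0 pG)
  sradF sradG (support_prod_support pF) (support_prod_support pG).
have iF := intersective_support spF; have iG := intersective_support spG.
by split=> [/crit|/crit'] [iUV iFG]; [apply/crit'|apply/crit]; split => //;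
  case: iFG => [/iF|/iG]; [left|right|left|right].
Qed.
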